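(* Let $MA\to\mathbb S^1$ be the torus bundle over $\mathbb S^1$ where $A=\begin{pmatrix}1&1\\0&1\end{pmatrix}$. $MA$ has just one free involution $\tau$ which is over $\mathbb S^1$ with $MA_\tau\simeq MB$, where $B=\begin{pmatrix}1&2\\0&1\end{pmatrix}$. Given a homotopy class $\delta=[f]\in[MA,0;MA,0]_{\mathbb S^1}$, the homomorphism $f_\#$ is given by $$f_\#(\alpha)=\alpha^{r},\qquad f_\#(\beta)=\alpha^{s}\beta^{r},\qquad f_\#(c)=\alpha^{u}\beta^{v}c .$$ The class $\delta$ has the Borsuk-Ulam property with respect to $\tau$ if and only if $r$ is even.
   Context: $\mathbb T^2=(\mathbb R\times\mathbb R)/(\mathbb Z\times\mathbb Z)$ with elements $[(x,y)]$. For a homeomorphism $A$ of $\mathbb T^2$ induced by a linear operator of $\mathbb R^2$ preserving $\mathbb Z\times\mathbb Z$ (the operator, its matrix and the homeomorphism are denoted by the same letter), $MA=\mathbb T^2\times[0,1]/\big(([(x,y)],0)\sim([A\binom{x}{y}],1)\big)$, with elements $\langle[(x,y)],t\rangle$ and bundle projection $p\colon MA\to\mathbb S^1=I/(0\sim1)$, $p(\langle[(x,y)],t\rangle)=\langle t\rangle$; $MB$ is defined in the same way from the matrix $B$. The base point $0$ of $MA$ is $\langle[(0,0)],0\rangle$. The loops $\alpha(t)=\langle[(t,0)],0\rangle$, $\beta(t)=\langle[(0,t)],0\rangle$, $c(t)=\langle[(0,0)],t\rangle$, $t\in[0,1]$, represent generators of $\pi_1(MA,0)$; for $A=\begin{pmatrix}1&1\\0&1\end{pmatrix}$,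 $\pi_1(MA,0)=\langle\alpha,\beta,c\mid[\alpha,\beta]=1,\ c\alpha c^{-1}=\alpha,\ c\beta c^{-1}=\alpha\beta\rangle$. The exponents $r,s,u,v$ are integers, and $f_\#\colon\pi_1(MA,0)\to\pi_1(MA,0)$ is the homomorphism induced by $f$. A map $f\colon MA\to MA$ (in particular an involution) is over $\mathbb S^1$ if $p\circ f=p$. $[MA,0;MA,0]_{\mathbb S^1}$ is the set of homotopy classes of pointed maps $(MA,0)\to(MA,0)$ over $\mathbb S^1$ under pointed homotopies through maps over $\mathbb S^1$. A class $\delta$ has the Borsuk-Ulam property with respect to $\tau$ if for every representative $f$ of $\delta$ there is $x\in MA$ with $f(\tau(x))=f(x)$. $MA_\tau$ is the orbit space of $MA$ by $\tau$. *)

(* Defs.v *)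
From HB Require Import structures.
From mathcomp Require Import all_boot all_order all_algebra.
From mathcomp Require Import generic_quotient.
From mathcomp Require Import all_classical all_reals.
From mathcomp Require Import topology normedtype wedge_sigT continuous_path.
From mathcomp Require Import ring lra.
From Stdlib Require Relation_Operators.

Set Implicit Arguments.
Unset Strict Implicit.
Unset Printing Implicit Defensive.

Import Order.TTheory GRing.Theory Num.Theory.
Import numFieldNormedType.Exports.

Local Open Scope classical_set_scope.
Local Open Scope quotient_scope.
Local Open Scope ring_scope.

Section Glue.
Context {T : topologicalType} (r : T -> T -> Prop).

Definition glued_rel (x y : T) : bool :=
  `[< Relation_Operators.clos_refl_sym_trans T r x y >].

Lemma glued_rel_refl : reflexive glued_rel.
Proof. by move=> x; apply/asboolP; exact: Relation_Operators.rst_refl. Qed.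

Lemma glued_rel_sym : symmetric glued_rel.
Proof.
by move=> x y; apply/asboolP/asboolP; exact: Relation_Operators.rst_sym.
Qed.

Lemma glued_rel_trans : transitive glued_rel.
Proof.
move=> y x z /asboolP xy /asboolP yz; apply/asboolP.
exact: Relation_Operators.rst_trans xy yz.
Qed.

Definition glued_equiv := EquivRel _ glued_rel_refl glued_rel_sym glued_rel_trans.

(* The topological quotient of T by the equivalence relation generated by r. *)
Definition glued : Type := quotient_topology {eq_quot glued_equiv}.

HB.instance Definition _ :=
  Topological.copy glued (quotient_topology {eq_quot glued_equiv}).
HB.instance Definition _ :=
  Quotient.copy glued (quotient_topology {eq_quot glued_equiv}).

Lemma glued_eq (x y : T) : r x y -> \pi_glued x = \pi_glued y.
Proof.
move=> rxy; apply/eqquotP => /=; apply/asboolP.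
exact: Relation_Operators.rst_step.
Qed.

Lemma glued_liftE {S : Type} (f : T -> S) :
  (forall x y, r x y -> f x = f y) -> forall x, f (repr (\pi_glued x)) = f x.
Proof.
move=> rf x.
have /eqquotP/asboolP : \pi_glued (repr (\pi_glued x)) = \pi_glued x.
  by rewrite reprK.
move: (repr _) => y.
by elim=> {x y} [u v /rf//|//|u v _ ->//|u v w _ -> _ ->].
Qed.

Lemma glued_pi_continuous : continuous (\pi_glued : T -> glued).
Proof. exact: (@pi_continuous _ {eq_quot glued_equiv}). Qed.

End Glue.

Section UnitInterval.
Context {R : realType}.

Definition I01 : Type := set_type (`[0, 1]%classic : set R).
HB.instance Definition _ := Topological.on I01.

Lemma clamp_subproof (x : R) :
  Num.max 0 (Num.min 1 x) \in (`[0, 1]%classic : set R).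
Proof.
by apply/mem_set; rewrite /= in_itv /= le_max lexx /= ge_max ler01 ge_min lexx.
Qed.

Definition clamp (x : R) : I01 := SigSub (clamp_subproof x).

Definition ival (t : I01) : R := \val t.

Lemma ival_ge0 t : 0 <= ival t.
Proof. by have := set_mem (valP t); rewrite /= in_itv /= => /andP[]. Qed.

Lemma ival_le1 t : ival t <= 1.
Proof. by have := set_mem (valP t); rewrite /= in_itv /= => /andP[]. Qed.

Lemma ivalK t : clamp (ival t) = t.
Proof.
apply: val_inj => /=.
have := ival_ge0 t; have := ival_le1 t; rewrite /ival => t1 t0.
by rewrite (min_idPr t1) (max_idPr t0).
Qed.

Lemma clampK x : 0 <= x <= 1 -> ival (clamp x) = x.
Proof. by move=> /andP[x0 x1]; rewrite /ival /= (min_idPr x1) (max_idPr x0). Qed.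

Lemma clamp_le0 x : x <= 0 -> clamp x = clamp 0.
Proof.
move=> x0; apply: val_inj => /=; rewrite (min_idPr _); last lra.
by rewrite (max_idPl x0) (min_idPr _) ?maxxx.
Qed.

Lemma clamp_ge1 x : 1 <= x -> clamp x = clamp 1.
Proof.
by move=> x1; apply: val_inj => /=; rewrite (min_idPl x1) minxx.
Qed.

Lemma ival_continuous : continuous ival.
Proof. exact: initial_continuous. Qed.

Lemma clamp_continuous : continuous clamp.
Proof.
move=> x; apply: continuous_comp_initial => /=.
move=> {x}; rewrite (_ : _ \o _ = fun x : R => Num.max 0 (Num.min 1 x)) // => x.
apply: continuous_max; first exact: cvg_cst.
by apply: continuous_min; [exact: cvg_cst|exact: cvg_id].
Qed.

Lemma clamp01_neq : clamp 0 != clamp 1.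
Proof.
apply/eqP => /(congr1 ival); rewrite !clampK ?lexx ?ler01 // => /eqP.
by rewrite eq_sym oner_eq0.
Qed.

End UnitInterval.
Arguments I01 R : clear implicits.

HB.instance Definition _ (R : realType) :=
  @isBiPointed.Build (I01 R) (clamp 0) (clamp 1) clamp01_neq.

Section UnitInterval2.
Context {R : realType}.

Lemma ival0 : ival (zero : I01 R) = 0.
Proof. by rewrite clampK// lexx ler01. Qed.

Lemma ival1 : ival (one : I01 R) = 1.
Proof. by rewrite clampK// lexx ler01. Qed.

End UnitInterval2.

(* f and g are joined by a homotopy each stage of which satisfies P. *)
Definition homotopic_in (R : realType) (X Y : topologicalType)
    (P : (X -> Y) -> Prop) (f g : X -> Y) : Prop :=
  exists H : X * I01 R -> Y,
    [/\ continuous H, (forall x, H (x, zero) = f x),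
        (forall x, H (x, one) = g x) & forall s, P (fun x => H (x, s))].

Lemma continuous_paste (R : realType) (X Y : topologicalType) (phi : X -> R)
    (f g : X -> Y) : continuous phi -> continuous f -> continuous g ->
  (forall x, phi x = 2^-1 -> f x = g x) ->
  continuous (fun x => if phi x <= 2^-1 then f x else g x).
Proof.
move=> cphi cf cg fg x.
have [ltx|gtx|eqx] := ltgtP (phi x) 2^-1.
- have Hn : \forall y \near x, f y = (if phi y <= 2^-1 then f y else g y).
    near=> y; rewrite ifT//; apply/ltW; near: y.
    exact: (cphi x _ (lt_nbhsl ltx)).
  by rewrite /continuous_at (ltW ltx); apply: (cvg_trans _ (cf x));
    apply: near_eq_cvg.
- have Hn : \forall y \near x, g y = (if phi y <= 2^-1 then f y else g y).
    near=> y; rewrite ifF//; apply/negbTE; rewrite -ltNge; near: y.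
    exact: (cphi x _ (lt_nbhsr gtx)).
  by rewrite /continuous_at leNgt gtx /=; apply: (cvg_trans _ (cg x));
    apply: near_eq_cvg.
- rewrite /continuous_at eqx lexx => U fU.
  have gU : nbhs (g x) U by rewrite -fg.
  have fy : \forall y \near x, U (f y) by exact: cf.
  have gy : \forall y \near x, U (g y) by exact: cg.
  by apply: filterS2 fy gy => y /= ? ?; case: ifP.
Unshelve. all: by end_near. Qed.

Lemma continuous_pair (X Y Z : topologicalType) (f : X -> Y) (g : X -> Z) :
  continuous f -> continuous g -> continuous (fun x => (f x, g x)).
Proof.
move=> cf cg x.
exact: (@cvg_pair _ _ _ _ (nbhs (f x)) (nbhs (g x)) _ _ _ f g (cf x) (cg x)).
Qed.

Lemma continuous_cmp (X Y Z : topologicalType) (g : Y -> Z) (f : X -> Y) :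
  continuous g -> continuous f -> continuous (fun x => g (f x)).
Proof. by move=> cg cf x; apply: (@continuous_comp _ _ _ f g);
  [exact: cf|exact: cg]. Qed.

Lemma continuous_affine (R : realType) (X : topologicalType) (f : X -> R)
    (a b : R) : continuous f -> continuous (fun x => a * f x + b).
Proof.
move=> cf x; apply: cvgD; last exact: cvg_cst.
by apply: cvgM; [exact: cvg_cst|exact: cf].
Qed.

Lemma continuous_fmax (R : realType) (X : topologicalType) (f g : X -> R) :
  continuous f -> continuous g -> continuous (fun x => Num.max (f x) (g x)).
Proof.
move=> cf cg x.
exact: (@continuous_max R X (f : X -> R^o) (g : X -> R^o) x (cf x) (cg x)).
Qed.

Lemma continuous_fmin (R : realType) (X : topologicalType) (f g : X -> R) :
  continuous f -> continuous g -> continuous (fun x => Num.min (f x) (g x)).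
Proof.
move=> cf cg x.
exact: (@continuous_min R X (f : X -> R^o) (g : X -> R^o) x (cf x) (cg x)).
Qed.

Lemma fst_continuous (X Y : topologicalType) : continuous (@fst X Y).
Proof. by move=> z; exact: cvg_fst. Qed.

Lemma snd_continuous (X Y : topologicalType) : continuous (@snd X Y).
Proof. by move=> z; exact: cvg_snd. Qed.

Lemma subr2_1 (R : realType) : 2 + -1 = 1 :> R.
Proof. by lra. Qed.

Section HomotopicEquivalence.
Context {R : realType} {X Y : topologicalType} (P : (X -> Y) -> Prop).
Local Notation hom := (@homotopic_in R X Y P).

Lemma homotopic_in_refl f : continuous f -> P f -> hom f f.
Proof.
move=> cf Pf; exists (fun z => f z.1); split => //.
exact: (continuous_cmp cf (@fst_continuous _ _)).
Qed.

Lemma homotopic_in_restage (a b : R) (H : X * I01 R -> Y) : continuous H ->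
  continuous (fun z => H (z.1, clamp (a * ival z.2 + b))).
Proof.
move=> cH; apply: (continuous_cmp cH).
apply: (continuous_pair (@fst_continuous _ _)).
apply: (continuous_cmp (@clamp_continuous _)); apply: continuous_affine.
exact: (continuous_cmp (@ival_continuous _) (@snd_continuous _ _)).
Qed.

Lemma homotopic_in_sym f g : hom f g -> hom g f.
Proof.
move=> [H [cH H0 H1 HP]].
exists (fun z => H (z.1, clamp (-1 * ival z.2 + 1))); split.
- exact: homotopic_in_restage.
- by move=> x; rewrite /= ival0 mulr0 add0r; exact: H1.
- by move=> x; rewrite /= ival1 mulr1 addNr; exact: H0.
- by move=> s /=; exact: HP.
Qed.

Lemma homotopic_in_trans f g h : hom f g -> hom g h -> hom f h.
Proof.
move=> [H [cH H0 H1 HP]] [K [cK K0 K1 KP]].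
exists (fun z => if ival z.2 <= 2^-1 then H (z.1, clamp (2 * ival z.2 + 0))
                 else K (z.1, clamp (2 * ival z.2 + -1))); split.
- apply: continuous_paste.
  + exact: (continuous_cmp (@ival_continuous _) (@snd_continuous _ _)).
  + exact: homotopic_in_restage.
  + exact: homotopic_in_restage.
  + move=> z ->; rewrite addr0 divff ?pnatr_eq0// subrr.
    by rewrite (H1 z.1 : H (_, clamp 1) = _) (K0 z.1 : K (_, clamp 0) = _).
- by move=> x; rewrite /= ival0 ifT ?invr_ge0// mulr0 addr0; exact: H0.
- move=> x; rewrite /= ival1 ifF; last by apply/negbTE; rewrite -ltNge; lra.
  by rewrite mulr1 subr2_1; exact: K1.
- by move=> s /=; case: (ival s <= _); [exact: HP|exact: KP].
Qed.

End HomotopicEquivalence.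

Section Pi1.
Context (R : realType) {X : topologicalType} (x : X).

Definition loop : Type := {path (I01 R) from x to x}.
HB.instance Definition _ := Choice.on loop.

Definition path_homotopic (p q : loop) : bool :=
  `[< @homotopic_in R (I01 R) X (fun f => f zero = x /\ f one = x) p q >].

Lemma loop_continuous (p : loop) : continuous p.
Proof. exact: cts_fun. Qed.

Lemma loop0 (p : loop) : p (clamp 0) = x.
Proof. exact: (@path_zero _ _ _ _ p). Qed.

Lemma loop1 (p : loop) : p (clamp 1) = x.
Proof. exact: (@path_one _ _ _ _ p). Qed.

Lemma path_homotopic_refl : reflexive path_homotopic.
Proof.
move=> p; apply/asboolP; apply: homotopic_in_refl; first exact: loop_continuous.
by rewrite path_zero path_one.
Qed.

Lemma path_homotopic_sym : symmetric path_homotopic.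
Proof. by move=> p q; apply/asboolP/asboolP; exact: homotopic_in_sym. Qed.

Lemma path_homotopic_trans : transitive path_homotopic.
Proof.
move=> q p s /asboolP pq /asboolP qs.
by apply/asboolP; exact: homotopic_in_trans pq qs.
Qed.

Definition path_homotopic_equiv := EquivRel _
  path_homotopic_refl path_homotopic_sym path_homotopic_trans.

Definition pi1 : Type := {eq_quot path_homotopic_equiv}.
HB.instance Definition _ := Choice.on pi1.
HB.instance Definition _ := EqQuotient.on pi1.

Lemma pi1_eqP (p q : loop) :
  reflect (@homotopic_in R (I01 R) X (fun f => f zero = x /\ f one = x) p q)
    (\pi_pi1 p == \pi_pi1 q).
Proof.
apply: (iffP eqP) => [/eqquotP/asboolP//|pq].
by apply/eqquotP; apply/asboolP.
Qed.

Lemma pi1_repr (p : loop) :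
  @homotopic_in R (I01 R) X (fun f => f zero = x /\ f one = x)
    (repr (\pi_pi1 p)) p.
Proof. by apply/pi1_eqP; rewrite reprK. Qed.

(* If phi sends the end points of [0, 1] to end points of [0, 1], the class of
   p \o phi only depends on the values of phi at 0 and 1. *)
Lemma reparam_homotopic (p : loop) (phi psi : I01 R -> R) :
  continuous phi -> continuous psi ->
  phi zero = psi zero -> phi one = psi one ->
  (phi zero = 0 \/ phi zero = 1) -> (phi one = 0 \/ phi one = 1) ->
  @homotopic_in R (I01 R) X (fun f => f zero = x /\ f one = x)
    (fun t => p (clamp (phi t))) (fun t => p (clamp (psi t))).
Proof.
move=> cphi cpsi e0 e1 v0 v1.
exists (fun z => p (clamp (phi z.1 + ival z.2 * (psi z.1 - phi z.1)))); split.
- apply: (continuous_cmp (@loop_continuous p)).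
  apply: (continuous_cmp (@clamp_continuous _)) => z.
  have c1 (f : I01 R -> R) : continuous f -> {for z, continuous (f \o fst)}.
    by move=> cf; apply: (continuous_cmp cf (@fst_continuous _ _)).
  apply: cvgD; first exact: c1.
  apply: cvgM; first exact: (continuous_cmp (@ival_continuous _)
    (@snd_continuous _ _)).
  by apply: cvgB; exact: c1.
- by move=> t /=; rewrite ival0 mul0r addr0.
- by move=> t /=; rewrite ival1 mul1r subrKC.
- move=> s /=; rewrite e0 e1 !subrr !mulr0 !addr0 -e0 -e1.
  by split; [case: v0|case: v1] => ->; rewrite ?loop0 ?loop1.
Qed.

Lemma reparam_homotopic_id (p : loop) (phi : I01 R -> R) :
  continuous phi -> phi zero = 0 -> phi one = 1 ->
  @homotopic_in R (I01 R) X (fun f => f zero = x /\ f one = x)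
    (fun t => p (clamp (phi t))) p.
Proof.
move=> cphi phi0 phi1.
suff : @homotopic_in R (I01 R) X (fun f => f zero = x /\ f one = x)
    (fun t => p (clamp (phi t))) (fun t => p (clamp (ival t))).
  by congr homotopic_in; apply/funext => t; rewrite ivalK.
apply: (@reparam_homotopic p phi ival) => //.
- exact: ival_continuous.
- by rewrite ival0.
- by rewrite ival1.
- by left.
- by right.
Qed.

Section Concat.
Context (p q : loop).

Definition loop_concat_fun (t : I01 R) : X :=
  if ival t <= 2^-1 then p (clamp (2 * ival t + 0))
  else q (clamp (2 * ival t + -1)).

Lemma loop_concat_continuous : continuous loop_concat_fun.
Proof.
apply: continuous_paste; first exact: ival_continuous.
- apply: (continuous_cmp (@loop_continuous p)).
  apply: (continuous_cmp (@clamp_continuous _)); apply: continuous_affine.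
  exact: ival_continuous.
- apply: (continuous_cmp (@loop_continuous q)).
  apply: (continuous_cmp (@clamp_continuous _)); apply: continuous_affine.
  exact: ival_continuous.
- move=> t ->; rewrite addr0 divff ?pnatr_eq0// subrr.
  by rewrite loop1 loop0.
Qed.

Lemma loop_concat0 : loop_concat_fun zero = x.
Proof.
rewrite /loop_concat_fun ival0 ifT ?invr_ge0// mulr0 addr0.
exact: loop0.
Qed.

Lemma loop_concat1 : loop_concat_fun one = x.
Proof.
rewrite /loop_concat_fun ival1 ifF; last by apply/negbTE; rewrite -ltNge; lra.
by rewrite mulr1 subr2_1; exact: loop1.
Qed.

Definition loop_concat : loop :=
  mk_path loop_concat_continuous loop_concat0 loop_concat1.

Lemma loop_concatE t : loop_concat t = if ival t <= 2^-1
  then p (clamp (2 * ival t + 0)) else q (clamp (2 * ival t + -1)).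
Proof. by []. Qed.

Definition loop_rev_fun (t : I01 R) : X := p (clamp (-1 * ival t + 1)).

Lemma loop_rev_continuous : continuous loop_rev_fun.
Proof.
apply: (continuous_cmp (@loop_continuous p)).
apply: (continuous_cmp (@clamp_continuous _)); apply: continuous_affine.
exact: ival_continuous.
Qed.

Lemma loop_rev0 : loop_rev_fun zero = x.
Proof. by rewrite /loop_rev_fun ival0 mulr0 add0r; exact: loop1. Qed.

Lemma loop_rev1 : loop_rev_fun one = x.
Proof. by rewrite /loop_rev_fun ival1 mulr1 addNr; exact: loop0. Qed.

Definition loop_rev : loop := mk_path loop_rev_continuous loop_rev0 loop_rev1.

Lemma loop_revE t : loop_rev t = p (clamp (-1 * ival t + 1)).
Proof. by []. Qed.

End Concat.

Definition loop_cst : loop := cst x.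

Definition pi1_mul (a b : pi1) : pi1 := \pi_pi1 (loop_concat (repr a) (repr b)).
Definition pi1_inv (a : pi1) : pi1 := \pi_pi1 (loop_rev (repr a)).
Definition pi1_one : pi1 := \pi_pi1 loop_cst.

Lemma pi1_mulE (p q : loop) :
  pi1_mul (\pi_pi1 p) (\pi_pi1 q) = \pi_pi1 (loop_concat p q).
Proof.
apply/eqP/pi1_eqP.
have [H [cH H0 H1 HP]] := pi1_repr p; have [K [cK K0 K1 KP]] := pi1_repr q.
exists (fun z => if ival z.1 <= 2^-1 then H (clamp (2 * ival z.1 + 0), z.2)
                 else K (clamp (2 * ival z.1 + -1), z.2)).
have cl (L : I01 R * I01 R -> X) (a b : R) : continuous L ->
    continuous (fun z => L (clamp (a * ival z.1 + b), z.2)).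
  move=> cL; apply: (continuous_cmp cL).
  apply: continuous_pair; last exact: snd_continuous.
  apply: (continuous_cmp (@clamp_continuous _)); apply: continuous_affine.
  exact: (continuous_cmp (@ival_continuous _) (@fst_continuous _ _)).
split.
- apply: continuous_paste; [|exact: cl|exact: cl|].
  + exact: (continuous_cmp (@ival_continuous _) (@fst_continuous _ _)).
  + move=> z ->; rewrite addr0 divff ?pnatr_eq0// subrr.
    by rewrite (HP z.2).2 (KP z.2).1.
- by move=> t /=; rewrite H0 K0.
- by move=> t /=; rewrite H1 K1.
- move=> s /=; rewrite ival0 ival1 ifT ?invr_ge0// mulr0 addr0; split.
    exact: (HP s).1.
  rewrite ifF; last by apply/negbTE; rewrite -ltNge; lra.
  by rewrite mulr1 subr2_1; exact: (KP s).2.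
Qed.

Lemma pi1_invE (p : loop) : pi1_inv (\pi_pi1 p) = \pi_pi1 (loop_rev p).
Proof.
apply/eqP/pi1_eqP; have [H [cH H0 H1 HP]] := pi1_repr p.
exists (fun z => H (clamp (-1 * ival z.1 + 1), z.2)); split.
- apply: (continuous_cmp cH); apply: continuous_pair; last exact: snd_continuous.
  apply: (continuous_cmp (@clamp_continuous _)); apply: continuous_affine.
  exact: (continuous_cmp (@ival_continuous _) (@fst_continuous _ _)).
- by move=> t; exact: H0.
- by move=> t; exact: H1.
- move=> s /=; rewrite ival0 ival1 mulr0 add0r mulr1 addNr.
  by split; [exact: (HP s).2|exact: (HP s).1].
Qed.

Lemma pi1_ind (P : pi1 -> Prop) :
  (forall p : loop, P (\pi_pi1 p)) -> forall a, P a.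
Proof. by move=> Pp a; rewrite -[a]reprK. Qed.

Lemma affine_ival_continuous (a b : R) :
  continuous (fun t : I01 R => a * ival t + b).
Proof. by apply: continuous_affine; exact: ival_continuous. Qed.

Lemma pi1_mulA : associative pi1_mul.
Proof.
elim/pi1_ind => p; elim/pi1_ind => q; elim/pi1_ind => s.
rewrite !pi1_mulE; apply/eqP/pi1_eqP.
pose phi (t : I01 R) : R :=
  Num.max (2^-1 * ival t + 0) (Num.max (1 * ival t + - 4^-1) (2 * ival t + -1)).
set m := loop_concat (loop_concat p q) s.
have phiE : loop_concat p (loop_concat q s) =1 (fun t => m (clamp (phi t))).
  move=> t; have t0 := ival_ge0 t; have t1 := ival_le1 t.
  rewrite /m !loop_concatE.
  have [h|h] := leP (ival t) 2^-1.
    have -> : phi t = 2^-1 * ival t.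
      by rewrite /phi addr0 (max_idPl _)// ge_max; apply/andP; split; lra.
    rewrite clampK; last by lra.
    rewrite ifT; last by lra.
    rewrite clampK; last by lra.
    rewrite ifT; last by lra.
    by congr (p (clamp _)); lra.
  rewrite clampK; last by lra.
  have [h'|h'] := leP (ival t) (3 / 4).
    have -> : phi t = ival t - 4^-1.
      rewrite /phi mul1r (@max_l _ _ (_ - _)); last by lra.
      by rewrite max_r//; lra.
    rewrite ifT; last by lra.
    rewrite clampK; last by lra.
    rewrite ifT; last by lra.
    rewrite clampK; last by lra.
    rewrite ifF; last by apply/negbTE; rewrite -ltNge; lra.
    by congr (q (clamp _)); lra.
  have -> : phi t = 2 * ival t - 1.
    rewrite /phi mul1r (@max_r _ _ (_ - _)); last by lra.
    by rewrite max_r//; lra.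
  rewrite ifF; last by apply/negbTE; rewrite -ltNge; lra.
  rewrite clampK; last by lra.
  rewrite ifF; last by apply/negbTE; rewrite -ltNge; lra.
  by congr (s (clamp _)); lra.
have -> : (loop_concat p (loop_concat q s) : I01 R -> X) =
  (fun t => m (clamp (phi t))) by apply/funext.
have phi0 : phi zero = 0.
  rewrite /phi ival0 !mulr0 addr0 !add0r max_l// ge_max.
  by apply/andP; split; lra.
have phi1 : phi one = 1.
  rewrite /phi ival1 !mulr1 addr0 (@max_r _ _ (1 - _)); last by lra.
  by rewrite max_r; lra.
apply: (@reparam_homotopic_id m phi) => //.
- exact: (continuous_fmax (@affine_ival_continuous _ _) (continuous_fmax
    (@affine_ival_continuous _ _) (@affine_ival_continuous _ _))).
Qed.

Lemma pi1_mul1 : left_id pi1_one pi1_mul.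
Proof.
elim/pi1_ind => p; rewrite pi1_mulE; apply/eqP/pi1_eqP.
have -> : (loop_concat loop_cst p : I01 R -> X) =
    (fun t => p (clamp (Num.max 0 (2 * ival t + -1)))).
  apply/funext => t; rewrite loop_concatE.
  have [h|h] := leP (ival t) 2^-1; last by rewrite max_r//; lra.
  by rewrite max_l; [rewrite loop0|lra].
have e0 : Num.max 0 (2 * ival (zero : I01 R) + -1) = 0.
  by rewrite ival0 max_l//; lra.
have e1 : Num.max 0 (2 * ival (one : I01 R) + -1) = 1.
  by rewrite ival1 max_r; lra.
apply: (@reparam_homotopic_id p (fun t => Num.max 0 (2 * ival t + -1))) => //.
- exact: (continuous_fmax (fun t => cvg_cst _) (@affine_ival_continuous _ _)).
Qed.

Lemma pi1_mulV : right_inverse pi1_one pi1_inv pi1_mul.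
Proof.
elim/pi1_ind => p; rewrite pi1_invE pi1_mulE; apply/eqP/pi1_eqP.
have -> : (loop_concat p (loop_rev p) : I01 R -> X) =
    (fun t => p (clamp (Num.min (2 * ival t + 0) (-2 * ival t + 2)))).
  apply/funext => t; rewrite loop_concatE.
  have t0 := ival_ge0 t; have t1 := ival_le1 t.
  have [h|h] := leP (ival t) 2^-1; first by rewrite min_l//; lra.
  rewrite loop_revE clampK; last by lra.
  by rewrite min_r; [congr (p (clamp _))|]; lra.
have -> : (loop_cst : I01 R -> X) = (fun t => p (clamp 0)).
  by apply/funext => t; rewrite loop0.
have e0 : Num.min (2 * ival (zero : I01 R) + 0) (-2 * ival (zero : I01 R) + 2)
    = 0.
  by rewrite ival0 min_l; lra.
have e1 : Num.min (2 * ival (one : I01 R) + 0) (-2 * ival (one : I01 R) + 2)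
    = 0.
  by rewrite ival1 min_r; lra.
apply: (@reparam_homotopic p
  (fun t => Num.min (2 * ival t + 0) (-2 * ival t + 2)) (fun=> 0)) => //.
- exact: (continuous_fmin (@affine_ival_continuous _ _)
    (@affine_ival_continuous _ _)).
- exact: cst_continuous.
- by left.
- by left.
Qed.

Lemma loop_revK (p : loop) : loop_rev (loop_rev p) = p.
Proof.
apply/path_eqP => t; rewrite !loop_revE.
have t0 := ival_ge0 t; have t1 := ival_le1 t.
rewrite clampK; last by lra.
by rewrite -[in RHS](ivalK t); congr (p (clamp _)); lra.
Qed.

Lemma pi1_mulVl : left_inverse pi1_one pi1_inv pi1_mul.
Proof.
elim/pi1_ind => p; rewrite -{2}(loop_revK p) -(pi1_invE (loop_rev p)) pi1_invE.
exact: pi1_mulV.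
Qed.

Lemma pi1_mul1r : right_id pi1_one pi1_mul.
Proof.
by move=> a; rewrite -(pi1_mulVl a) pi1_mulA pi1_mulV pi1_mul1.
Qed.

HB.instance Definition _ := isGroup.Build pi1
  pi1_mulA pi1_mul1 pi1_mul1r pi1_mulVl pi1_mulV.

End Pi1.

Section InducedHomomorphism.
Context {R : realType} {X Y : topologicalType} (f : X -> Y) (x : X) (y : Y).
Context (cf : continuous f) (fx : f x = y).

Section LoopMap.
Context (p : loop R x).

Lemma loop_map_continuous : continuous (f \o p).
Proof. exact: (continuous_cmp cf (@loop_continuous _ _ _ p)). Qed.

Lemma loop_map0 : (f \o p) zero = y.
Proof. by rewrite /= -fx; congr f; exact: loop0. Qed.

Lemma loop_map1 : (f \o p) one = y.
Proof. by rewrite /= -fx; congr f; exact: loop1. Qed.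

Definition loop_map : loop R y :=
  mk_path loop_map_continuous loop_map0 loop_map1.

Lemma loop_mapE t : loop_map t = f (p t).
Proof. by []. Qed.

End LoopMap.

Definition pi1_map (a : pi1 R x) : pi1 R y := \pi_(pi1 R y) (loop_map (repr a)).

Lemma pi1_mapE (p : loop R x) :
  pi1_map (\pi_(pi1 R x) p) = \pi_(pi1 R y) (loop_map p).
Proof.
apply/eqP/pi1_eqP; have [H [cH H0 H1 HP]] := pi1_repr p.
exists (fun z => f (H z)); split.
- exact: (continuous_cmp cf cH).
- by move=> t; rewrite H0.
- by move=> t; rewrite H1.
- by move=> s; rewrite (HP s).1 (HP s).2.
Qed.

Lemma pi1_mapM : {morph pi1_map : a b / (a * b)%g >-> (a * b)%g}.
Proof.
elim/pi1_ind => p; elim/pi1_ind => q.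
rewrite [(\pi_(pi1 R x) p * \pi_(pi1 R x) q)%g]pi1_mulE !pi1_mapE.
rewrite [RHS]pi1_mulE; congr (\pi_(pi1 R y) _).
apply/path_eqP => t; rewrite loop_mapE !loop_concatE !loop_mapE.
by case: (ival t <= _).
Qed.

HB.instance Definition _ := isMultiplicative.Build _ _ pi1_map pi1_mapM.

End InducedHomomorphism.

Definition expgz (G : groupType) (g : G) (n : int) : G :=
  match n with Posz k => (g ^+ k)%g | Negz k => (g ^- k.+1)%g end.

Definition homeomorphism (X Y : topologicalType) (h : X -> Y) : Prop :=
  continuous h /\
  exists k : Y -> X, [/\ continuous k, cancel h k & cancel k h].

Definition homeomorphic (X Y : topologicalType) : Prop :=
  exists h : X -> Y, homeomorphism h.

Definition mx2 (a b c d : int) : 'M[int]_2 :=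
  \matrix_(i < 2, j < 2)
    if i == 0 then (if j == 0 then a else b) else (if j == 0 then c else d).

Section Torus.
Context (R : realType).

Definition torus_rel (u v : R * R) : Prop :=
  u.1 - v.1 \is a Num.int /\ u.2 - v.2 \is a Num.int.

Definition torus : Type := glued torus_rel.
HB.instance Definition _ := Topological.on torus.
HB.instance Definition _ := Quotient.on torus.

Definition tor (x y : R) : torus := \pi_torus (x, y).

Definition linop (A : 'M[int]_2) (v : R * R) : R * R :=
  ((A 0 0)%:~R * v.1 + (A 0 1)%:~R * v.2,
   (A 1 0)%:~R * v.1 + (A 1 1)%:~R * v.2).

(* The self-map of the torus induced by A; by torus_mapE below it does not
   depend on the representative. *)
Definition torus_map (A : 'M[int]_2) (q : torus) : torus :=
  \pi_torus (linop A (repr q)).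

Lemma torus_mapE (A : 'M[int]_2) (x y : R) :
  torus_map A (tor x y) =
  tor ((A 0 0)%:~R * x + (A 0 1)%:~R * y) ((A 1 0)%:~R * x + (A 1 1)%:~R * y).
Proof.
apply: (@glued_liftE _ torus_rel _ (fun v => \pi_torus (linop A v))).
move=> u v [uv1 uv2]; apply: (@glued_eq _ torus_rel); split => /=.
- rewrite (_ : _ - _ = (A 0 0)%:~R * (u.1 - v.1) + (A 0 1)%:~R * (u.2 - v.2)).
    by rewrite rpredD// rpredM// intr_int.
  by ring.
- rewrite (_ : _ - _ = (A 1 0)%:~R * (u.1 - v.1) + (A 1 1)%:~R * (u.2 - v.2)).
    by rewrite rpredD// rpredM// intr_int.
  by ring.
Qed.

Lemma tor_continuous : continuous (fun v : R * R => tor v.1 v.2).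
Proof.
rewrite (_ : (fun v => _) = \pi_torus); last by apply/funext => -[].
exact: (@glued_pi_continuous _ torus_rel).
Qed.

Lemma tor_period10 : tor 1 0 = tor 0 0.
Proof.
by apply: (@glued_eq _ torus_rel); split; rewrite /= subr0; [exact: int_num1|
  exact: int_num0].
Qed.

Lemma tor_period01 : tor 0 1 = tor 0 0.
Proof.
by apply: (@glued_eq _ torus_rel); split; rewrite /= subr0; [exact: int_num0|
  exact: int_num1].
Qed.

Definition circle : Type := glued (fun s t : I01 R => s = zero /\ t = one).
HB.instance Definition _ := Topological.on circle.
HB.instance Definition _ := Quotient.on circle.

End Torus.

Section TorusBundle.
Context (R : realType) (A : 'M[int]_2).

Definition bundle_rel (a b : torus R * I01 R) : Prop :=
  a.2 = zero /\ b = (torus_map A a.1, one).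

Definition torus_bundle : Type := glued bundle_rel.
HB.instance Definition _ := Topological.on torus_bundle.
HB.instance Definition _ := Quotient.on torus_bundle.

(* The point <q, t>. *)
Definition bpt (q : torus R) (t : I01 R) : torus_bundle :=
  \pi_torus_bundle (q, t).

(* The bundle projection p : MA -> S^1; see bprojE below. *)
Definition bproj (z : torus_bundle) : circle R := \pi_(circle R) (repr z).2.

Lemma bprojE q t : bproj (bpt q t) = \pi_(circle R) t.
Proof.
apply: (@glued_liftE _ bundle_rel _ (fun z => \pi_(circle R) z.2)).
by move=> a b [-> ->]; apply: glued_eq.
Qed.

Lemma bpt_continuous : continuous (fun z : torus R * I01 R => bpt z.1 z.2).
Proof.
rewrite (_ : (fun z => _) = \pi_torus_bundle); last by apply/funext => -[].
exact: (@glued_pi_continuous _ bundle_rel).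
Qed.

Lemma bpt_glue q : bpt q zero = bpt (torus_map A q) one.
Proof. exact: (@glued_eq _ bundle_rel). Qed.

Definition bbase : torus_bundle := bpt (tor 0 0) zero.

Definition fiber_loop_fun (a b : R) (t : I01 R) : torus_bundle :=
  bpt (tor (a * ival t) (b * ival t)) zero.

Lemma fiber_loop_continuous a b : continuous (fiber_loop_fun a b).
Proof.
apply: (@continuous_cmp _ (torus R * I01 R)%type _ (fun z => bpt z.1 z.2)
  (fun t => (tor (a * ival t) (b * ival t), zero))); first exact: bpt_continuous.
apply: continuous_pair; last exact: cst_continuous.
apply: (@continuous_cmp _ (R * R)%type _ (fun v => tor v.1 v.2)
  (fun t => (a * ival t, b * ival t))); first exact: tor_continuous.
have c (k : R) : continuous (fun t : I01 R => k * ival t).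
  rewrite (_ : (fun _ => _) = fun t : I01 R => k * ival t + 0).
    exact: affine_ival_continuous.
  by apply/funext => t; rewrite addr0.
exact: continuous_pair.
Qed.

Lemma fiber_loop0 a b : fiber_loop_fun a b zero = bbase.
Proof. by rewrite /fiber_loop_fun ival0 !mulr0. Qed.

Lemma fiber_loop10 : fiber_loop_fun 1 0 one = bbase.
Proof. by rewrite /fiber_loop_fun ival1 mul1r mul0r tor_period10. Qed.

Lemma fiber_loop01 : fiber_loop_fun 0 1 one = bbase.
Proof. by rewrite /fiber_loop_fun ival1 mul1r mul0r tor_period01. Qed.

Definition loop_alpha : loop R bbase :=
  mk_path (@fiber_loop_continuous 1 0) (@fiber_loop0 1 0) fiber_loop10.

Definition loop_beta : loop R bbase :=
  mk_path (@fiber_loop_continuous 0 1) (@fiber_loop0 0 1) fiber_loop01.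

Definition base_loop_fun (t : I01 R) : torus_bundle := bpt (tor 0 0) t.

Lemma base_loop_continuous : continuous base_loop_fun.
Proof.
apply: (@continuous_cmp _ (torus R * I01 R)%type _ (fun z => bpt z.1 z.2)
  (fun t => (tor 0 0, t))); first exact: bpt_continuous.
by apply: continuous_pair; [exact: cst_continuous|move=> t; exact: cvg_id].
Qed.

Lemma base_loop0 : base_loop_fun zero = bbase. Proof. by []. Qed.

Lemma base_loop1 : base_loop_fun one = bbase.
Proof. by rewrite /bbase bpt_glue torus_mapE !mulr0 !addr0. Qed.

Definition loop_c : loop R bbase :=
  mk_path base_loop_continuous base_loop0 base_loop1.

Definition cls (p : loop R bbase) : pi1 R bbase := \pi_(pi1 R bbase) p.

Definition pointed_over (f : torus_bundle -> torus_bundle) : Prop :=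
  f bbase = bbase /\ forall z, bproj (f z) = bproj z.

Record pointed_map : Type := PointedMap {
  pointed_map_fun :> torus_bundle -> torus_bundle;
  pointed_map_continuous : continuous pointed_map_fun;
  pointed_map_pointed_over : pointed_over pointed_map_fun }.

HB.instance Definition _ := gen_eqMixin pointed_map.
HB.instance Definition _ := gen_choiceMixin pointed_map.

Definition pointed_map_homotopic (f g : pointed_map) : bool :=
  `[< @homotopic_in R _ _ pointed_over f g >].

Lemma pointed_map_homotopic_refl : reflexive pointed_map_homotopic.
Proof.
move=> f; apply/asboolP; apply: homotopic_in_refl.
  exact: pointed_map_continuous.
exact: pointed_map_pointed_over.
Qed.

Lemma pointed_map_homotopic_sym : symmetric pointed_map_homotopic.
Proof. by move=> f g; apply/asboolP/asboolP; exact: homotopic_in_sym. Qed.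

Lemma pointed_map_homotopic_trans : transitive pointed_map_homotopic.
Proof.
move=> g f h /asboolP fg /asboolP gh.
by apply/asboolP; exact: homotopic_in_trans fg gh.
Qed.

Definition pointed_map_homotopic_equiv := EquivRel _
  pointed_map_homotopic_refl pointed_map_homotopic_sym
  pointed_map_homotopic_trans.

(* The set [MA, 0; MA, 0]_{S^1}: pointed_over only constrains base point and
   projection, continuity of the stages comes from the homotopy. *)
Definition pointed_class : Type := {eq_quot pointed_map_homotopic_equiv}.
HB.instance Definition _ := Choice.on pointed_class.
HB.instance Definition _ := EqQuotient.on pointed_class.

(* The homomorphism f_# induced on the fundamental group. *)
Definition pointed_map_pi1 (f : pointed_map) : pi1 R bbase -> pi1 R bbase :=
  pi1_map (@pointed_map_continuous f) (proj1 (pointed_map_pointed_over f)).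

Definition induces_exponents (f : pointed_map) (r s u v : int) : Prop :=
  let alpha := cls loop_alpha in
  let beta := cls loop_beta in
  let c := cls loop_c in
  [/\ pointed_map_pi1 f alpha = expgz alpha r,
      pointed_map_pi1 f beta = (expgz alpha s * expgz beta r)%g &
      pointed_map_pi1 f c = (expgz alpha u * expgz beta v * c)%g].

Record free_involution_over (tau : torus_bundle -> torus_bundle) : Prop :=
  FreeInvolutionOver {
    fio_continuous : continuous tau;
    fio_involutive : involutive tau;
    fio_free : forall z, tau z <> z;
    fio_over : forall z, bproj (tau z) = bproj z }.

Definition orbit_space (tau : torus_bundle -> torus_bundle) : Type :=
  glued (fun z w => w = tau z).
HB.instance Definition _ tau := Topological.on (orbit_space tau).

Definition borsuk_ulam (tau : torus_bundle -> torus_bundle)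
    (delta : pointed_class) : Prop :=
  forall f : pointed_map, \pi_pointed_class f = delta ->
    exists z, f (tau z) = f z.

End TorusBundle.

Definition conjugate_maps (X : topologicalType) (tau tau' : X -> X) : Prop :=
  exists2 h : X -> X, homeomorphism h & forall z, h (tau z) = tau' (h z).

(* Main.v *)
Require Import Defs.
From mathcomp Require Import all_boot all_order all_algebra generic_quotient.
From mathcomp Require Import all_classical all_reals topology.
From mathcomp Require Import normedtype continuous_path zify ring lra.

(** Everything takes place in the universal covering R^3 -> M_k of the bundle
    of the shear (x, y) |-> (x + k y, y), where M_1 = MA and M_2 = MB. Its deck
    group is a Heisenberg group, the set Z^3 acting by
      (a, b, n) (x, y, t) = (x + k n y + a, y + b, t + n),
    with generators alpha, beta, c.

    Maps over the circle. A map f over the circle lifts to a map F that keeps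
    the height t, and commutation with the shear forces
      F (q + (a, b)) = F q + (r a + s b, r b),  F (c e) = (u, v, 1) F e
    (over_lift). Loops are classified by the end points of their lifts
    (ends_eq, ends_inj), so r, s, u, v are the exponents of f, and two maps
    with the same exponents are homotopic along the segments between their
    lifts (same_exponents_homotopic).

    Free involutions. A free involution over the circle has a lift T that
    commutes with the deck group and satisfies T^2 = alpha
    (free_involution_lift). Otherwise some lift T would be an involution, and
    T e - e an odd map into the punctured plane: its angle grows by an odd
    number of half turns from e to T e, hence by a nonzero amount from e to
    T (T e) = e. The example is the translation by (1/2, 0). If moreover the
    orbit space is MB, then R^3 -> MA_tau = MB is a universal covering of MB,
    so a homeomorphism F of R^3 turns the deck group of MA together with T
    into the deck group of MB. There T becomes central, that is, a translation
    by an odd integer along x, and the deck group of MA becomes the kernel of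
    a homomorphism to Z/2 that does not vanish at a. A linear change of
    coordinates brings this kernel to the standard position, where tau is the
    translation by (1/2, 0) (conjugate_half_shift).

    The Borsuk-Ulam property. Suppose r is even and f has no coincidence. Then
    F (T e) - F e - (r/2, 0) is a map into the punctured plane which is odd
    with respect to T, so its winding number w along alpha = T^2 is odd. It is
    invariant under beta, along which it has some winding number w', and the
    monodromy c transforms it by the shear, which does not change winding
    numbers; as c beta = alpha beta c, this gives w + w' = w', a contradiction
    (no_odd_winding, even_coincidence). If r is odd, let L be the matrix with
    rows (r, s) and (0, r). The average of L e and L (T e), corrected by a
    function of the height, is the lift of a map homotopic to f, and its values
    at T e and e differ by (r/2, 0), which is not an integer vector
    (averaged_lift, odd_no_coincidence). *)

Set Implicit Arguments.
Unset Strict Implicit.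
Unset Printing Implicit Defensive.

Import Order.TTheory GRing.Theory Num.Theory.
Import numFieldNormedType.Exports.

Local Open Scope classical_set_scope.
Local Open Scope quotient_scope.
Local Open Scope ring_scope.

(** * Continuous, open and quotient maps *)

Record open_map (X Y : topologicalType) (p : X -> Y) : Prop := OpenMap {
  open_image : forall U : set X, open U -> open (p @` U) }.

Lemma paste_at (R : realType) (X Y : topologicalType) (phi : X -> R) (a : R)
    (f g : X -> Y) (x : X) : {for x, continuous phi} ->
  {for x, continuous f} -> {for x, continuous g} -> (phi x = a -> f x = g x) ->
  {for x, continuous (fun x => if phi x <= a then f x else g x)}.
Proof.
move=> cphi cf cg fg; have [ltx|gtx|eqx] := ltgtP (phi x) a.
- have Hn : \forall y \near x, f y = (if phi y <= a then f y else g y).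
    near=> y; rewrite ifT//; apply/ltW; near: y.
    exact: (cphi _ (lt_nbhsl ltx)).
  rewrite /prop_for /continuous_at (ltW ltx); apply: (cvg_trans _ cf).
  exact: near_eq_cvg.
- have Hn : \forall y \near x, g y = (if phi y <= a then f y else g y).
    near=> y; rewrite ifF//; apply/negbTE; rewrite -ltNge; near: y.
    exact: (cphi _ (lt_nbhsr gtx)).
  rewrite /prop_for /continuous_at leNgt gtx /=; apply: (cvg_trans _ cg).
  exact: near_eq_cvg.
- rewrite /prop_for /continuous_at eqx lexx => U fU.
  have gU : nbhs (g x) U by rewrite -fg.
  have fy : \forall y \near x, U (f y) by exact: cf.
  have gy : \forall y \near x, U (g y) by exact: cg.
  by apply: filterS2 fy gy => y /= ? ?; case: ifP.
Unshelve. all: by end_near. Qed.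

Lemma eq_near_at (X Y : topologicalType) (f g : X -> Y) x :
  (\forall y \near x, f y = g y) -> {for x, continuous f} ->
  {for x, continuous g}.
Proof.
move=> fg cf; rewrite /prop_for /continuous_at -(nbhs_singleton fg).
by apply: (cvg_trans _ cf); apply: near_eq_cvg.
Qed.

Section Continuity.
Context {R : realType}.

Lemma continuous_add (X : topologicalType) (f g : X -> R) :
  continuous f -> continuous g -> continuous (fun x => f x + g x).
Proof. by move=> cf cg x; apply: cvgD; [exact: cf|exact: cg]. Qed.

Lemma continuous_mul (X : topologicalType) (f g : X -> R) :
  continuous f -> continuous g -> continuous (fun x => f x * g x).
Proof. by move=> cf cg x; apply: cvgM; [exact: cf|exact: cg]. Qed.

Lemma continuous_opp (X : topologicalType) (f : X -> R) :
  continuous f -> continuous (fun x => - f x).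
Proof. by move=> cf x; apply: cvgN; exact: cf. Qed.

Lemma continuous_cst (X Y : topologicalType) (a : Y) :
  continuous (fun _ : X => a).
Proof. exact: cst_continuous. Qed.

Lemma continuous_idf (X : topologicalType) : continuous (fun x : X => x).
Proof. by move=> x; exact: cvg_id. Qed.

End Continuity.

(** Continuity of an expression built from coordinates, ring operations and
    functions known to be continuous, by recursion on its syntax. *)
Ltac ctn := match goal with
  | |- continuous (fun _ => ?a) => exact: continuous_cst
  | |- continuous (fun x => x) => exact: continuous_idf
  | |- continuous (fun e => (@?f e, @?g e)) =>
      apply: (@continuous_pair _ _ _ f g); ctn
  | |- continuous (fun e => @?f e + @?g e) =>
      apply: (@continuous_add _ _ f g); ctn
  | |- continuous (fun e => @?f e * @?g e) =>
      apply: (@continuous_mul _ _ f g); ctn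
  | |- continuous (fun e => - @?f e) => apply: (@continuous_opp _ _ f); ctn
  | |- continuous (fun e => (@?f e).1) =>
      apply: (@continuous_cmp _ _ _ fst f); [exact: fst_continuous|ctn]
  | |- continuous (fun e => (@?f e).2) =>
      apply: (@continuous_cmp _ _ _ snd f); [exact: snd_continuous|ctn]
  | H : continuous ?F |- continuous (fun e => ?F (@?g e)) =>
      apply: (@continuous_cmp _ _ _ F g H); ctn
  | |- _ => assumption
  end.

Section OpenMaps.
Context {E Y : topologicalType} (p : E -> Y).
Hypotheses (op : open_map p) (sp : forall y, exists e, p e = y).

Lemma descend (Z : topologicalType) (g : E -> Z) : continuous g ->
  (forall e e', p e = p e' -> g e = g e') ->
  exists2 f : Y -> Z, continuous f & forall e, f (p e) = g e.
Proof.
move=> cg gp; have /choice[s sE] := sp.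
have fp e : g (s (p e)) = g e by apply: gp.
exists (g \o s) => //; apply/continuousP => A oA.
rewrite (_ : _ @^-1` A = p @` (g @^-1` A)).
  by apply: (open_image op); move/continuousP : cg; exact.
apply/seteqP; split=> y /= => [gy|[e Ae <-]]; first by exists (s y).
by rewrite fp.
Qed.

(** The product of a quotient map with an identity need not be a quotient map,
    but openness survives: this lets homotopies descend. *)
Lemma open_map_prod (T : topologicalType) :
  open_map (fun z : E * T => (p z.1, z.2)).
Proof.
split=> U oU; rewrite openE => _ [[e t] Uet <-] /=.
have : nbhs (e, t) U by exact: open_nbhs_nbhs.
move=> [[A B] /= [Ae Bt] AB]; exists (p @` A°, B) => /=.
  split=> //; apply: open_nbhs_nbhs; split.
    by apply: (open_image op); exact: open_interior.
  by exists e => //; exact: nbhs_singleton (nbhs_interior Ae).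
move=> [y s] /= [[e' Ae' <-] Bs]; exists (e', s) => //.
by apply: AB; split => //; exact: interior_subset.
Qed.

End OpenMaps.

Lemma descend_homotopy (E Y T Z : topologicalType) (p : E -> Y)
    (g : E * T -> Z) : open_map p ->
  (forall y, exists e, p e = y) -> continuous g ->
  (forall e e' t, p e = p e' -> g (e, t) = g (e', t)) ->
  exists2 f : Y * T -> Z, continuous f & forall e t, f (p e, t) = g (e, t).
Proof.
move=> op sp cg gp.
have sp' (y : Y * T) : exists z : E * T, (p z.1, z.2) = y.
  by case: y => y t; have [e <-] := sp y; exists (e, t).
have [z z' []|f cf fE] := descend (open_map_prod op T) sp' cg.
  by case: z z' => e t [e' t'] /= pe <-; exact: gp.
by exists f => // e t; rewrite -fE.
Qed.

Lemma same_fibres_homeomorphism (E Y Z : topologicalType) (p : E -> Y)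
    (q : E -> Z) :
  continuous p -> open_map p -> (forall y, exists e, p e = y) ->
  continuous q -> open_map q -> (forall y, exists e, q e = y) ->
  (forall e e', p e = p e' <-> q e = q e') ->
  exists2 h : Y -> Z, homeomorphism h & forall e, h (p e) = q e.
Proof.
move=> cp op sp cq oq sq pq.
have [h ch hE] := descend op sp cq (fun e e' => (pq e e').1).
have [k ck kE] := descend oq sq cp (fun e e' => (pq e e').2).
exists h => //; split => //; exists k; split => //.
- by move=> y; have [e <-] := sp y; rewrite hE kE.
- by move=> y; have [e <-] := sq y; rewrite kE hE.
Qed.

Lemma open_map_comp (X Y Z : topologicalType) (f : X -> Y) (g : Y -> Z) :
  open_map f -> open_map g -> open_map (g \o f).
Proof.
move=> of_ og; split=> U oU; rewrite -image_comp.
by apply: (open_image og); exact: open_image.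
Qed.

Lemma homeomorphism_open (X Y : topologicalType) (h : X -> Y) :
  homeomorphism h -> open_map h.
Proof.
move=> [ch [k [ck hk kh]]]; split=> U oU; rewrite (_ : h @` U = k @^-1` U).
  by move/continuousP : ck; exact.
apply/seteqP; split => y /= => [[x Ux <-]|Uky]; first by rewrite hk.
by exists (k y).
Qed.

(** Applied to A = \pi @` U, this reduces the openness of the projection to the
    openness of the saturation of U. *)
Lemma open_glued (T : topologicalType) (r : T -> T -> Prop)
    (A : set (glued r)) :
  open (\pi_(glued r) @^-1` A) -> open A.
Proof. by []. Qed.

(** Gluing generates an equivalence relation, which is therefore contained in
    every equivalence relation s that contains the gluing. *)
Lemma glued_class (T : topologicalType) (r s : T -> T -> Prop) :
  (forall x y, r x y -> s x y) -> (forall x, s x x) ->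
  (forall x y, s x y -> s y x) ->
  (forall x y z, s x y -> s y z -> s x z) ->
  forall x y, \pi_(glued r) x = \pi_(glued r) y -> s x y.
Proof.
move=> rs s1 sV sM x y xy.
have e : s (repr (\pi_(glued r) x)) = s x.
  apply: (@glued_liftE _ r) => u v /rs uv; apply/funext => z; apply/propext.
  by split; [apply: sM; exact: sV|exact: sM].
have e' : s (repr (\pi_(glued r) y)) = s y.
  apply: (@glued_liftE _ r) => u v /rs uv; apply/funext => z; apply/propext.
  by split; [apply: sM; exact: sV|exact: sM].
by rewrite -e xy e'.
Qed.

Lemma homeomorphism_inv (X Y : topologicalType) (h : X -> Y) :
  homeomorphism h ->
  exists k : Y -> X, [/\ homeomorphism k, cancel h k & cancel k h].
Proof.
by move=> [ch [k [ck hk kh]]]; exists k; split => //; split => //; exists h.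
Qed.

Lemma homeomorphism_comp (X Y Z : topologicalType) (h : X -> Y) (k : Y -> Z) :
  homeomorphism h -> homeomorphism k -> homeomorphism (k \o h).
Proof.
move=> [ch [h' [ch' hK h'K]]] [ck [k' [ck' kK k'K]]].
split; first exact: (continuous_cmp ck ch).
exists (h' \o k'); split; first exact: (continuous_cmp ch' ck').
  exact: can_comp.
exact: can_comp.
Qed.

(** * Covering spaces and lifting *)

Section Covering.
Context {R : realType} {E Y : topologicalType} (p : E -> Y)
  (G : set (E -> E)).

(** A regular covering with deck group G, given as a set of maps that acts
    simply transitively on the fibres. *)
Record deck_covering : Prop := DeckCovering {
  dc_continuous : continuous p;
  dc_open : open_map p;
  dc_surj : forall y, exists e, p e = y;
  dc_deck_continuous : forall g, G g -> continuous g;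
  dc_deck : forall g e, G g -> p (g e) = p e;
  dc_trans : forall e e', p e = p e' -> exists2 g, G g & g e = e';
  dc_free : forall g g' e, G g -> G g' -> g e = g' e -> g = g';
  dc_inj : forall e, exists U, open_nbhs e U /\ {in U &, injective p} }.

Hypothesis dc : deck_covering.

(** Both sides lie in an open set on which p is injective. *)
Lemma lifts_near (W : topologicalType) (f f' : W -> E) (w : W) g :
  {for w, continuous f} -> {for w, continuous f'} ->
  (\forall v \near w, p (f v) = p (f' v)) -> G g -> f' w = g (f w) ->
  \forall v \near w, f' v = g (f v).
Proof.
move=> cf cf' pf Gg f'w; have [U [oU injU]] := dc_inj dc (f' w).
have UN : nbhs (f' w) U by exact: open_nbhs_nbhs.
have cgf : {for w, continuous (g \o f)}.
  by apply: continuous_comp => //; exact: (dc_deck_continuous dc Gg).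
have U1 : \forall v \near w, U (f' v) by exact: cf'.
have U2 : \forall v \near w, U (g (f v)).
  by apply: (cgf U); rewrite /= -f'w.
near=> v; apply: injU.
- by apply/mem_set; near: v.
- by apply/mem_set; near: v.
- by rewrite (dc_deck dc _ Gg); symmetry; near: v.
Unshelve. all: by end_near. Qed.

Lemma clopen_line (A : set R) (x0 : R) : A x0 -> open A -> open (~` A) ->
  forall x, A x.
Proof.
move=> Ax0 oA oCA x.
have cR : connected [set: R] by apply/connected_intervalP => ? ?.
have -> // : A = [set: R].
apply: cR; first by exists x0.
- by exists A => //; rewrite setTI.
- by exists A; rewrite ?setTI// -openC.
Qed.

(** The points where f' = g f form a clopen set: by freeness, at any other point
    f' = h f nearby with h different from g. *)
Lemma path_lifts_deck (f f' : R -> E) : continuous f -> continuous f' ->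
  (forall x, p (f x) = p (f' x)) -> exists2 g, G g & forall x, f' x = g (f x).
Proof.
move=> cf cf' pf; have [g Gg gf] := dc_trans dc (pf 0).
exists g => //.
have nr v h : G h -> f' v = h (f v) -> \forall u \near v, f' u = h (f u).
  move=> Gh hv; apply: lifts_near Gh hv; [exact: cf|exact: cf'|].
  by apply: filterE => u; exact: pf.
apply: (@clopen_line [set x | f' x = g (f x)] 0) => //.
  by rewrite openE => x /= /(nr x g Gg).
rewrite openE => x /= nx; have [h Gh hf] := dc_trans dc (pf x).
have := nr x h Gh (esym hf).
rewrite /interior; apply: filterS => y /= -> hg.
by apply: nx; rewrite -hf (dc_free dc Gh Gg hg).
Qed.

Lemma path_lift_unique (f f' : R -> E) : continuous f -> continuous f' ->
  (forall x, p (f x) = p (f' x)) -> forall x0, f x0 = f' x0 -> f =1 f'.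
Proof.
move=> cf cf' pf x0 fx0.
have [g Gg gE] := path_lifts_deck cf cf' pf.
have [h Gh hE] := path_lifts_deck cf cf (fun=> erefl).
move=> x; rewrite gE {1}hE (@dc_free dc g h (f x0))//.
by rewrite -gE -hE.
Qed.

(** The inverse of p on an open set where p is injective; it is continuous
    because p is open. *)
Lemma local_section (e0 : E) : exists V : set Y, exists sigma : Y -> E,
  [/\ open V, V (p e0), forall y, V y -> {for y, continuous sigma} &
      forall y, V y -> p (sigma y) = y].
Proof.
have [U [[oU Ue0] injU]] := dc_inj dc e0.
have /choice[sigma sP] : forall y, exists e, (p @` U) y -> U e /\ p e = y.
  move=> y; have [[e Ue pe]|nU] := pselect ((p @` U) y); first by exists e.
  by exists e0.
exists (p @` U), sigma; split.
- exact: (open_image (dc_open dc)).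
- by exists e0.
- move=> y Vy N /=; rewrite nbhsE /= => -[N' [oN' N's] N'N].
  have [Us ps] := sP y Vy.
  rewrite /nbhs_simpl /= nbhsE /=; exists (p @` (N' `&` U)).
    split; first by apply: (open_image (dc_open dc)); exact: openI.
    by exists (sigma y).
  move=> z [u [N'u Uu] puz]; have Vz : (p @` U) z by exists u.
  have [Usz psz] := sP z Vz; apply: N'N.
  by rewrite (_ : sigma z = u)//; apply: injU; rewrite ?psz//; exact/mem_set.
- by move=> y /sP[].
Qed.

Section HomotopyLifting.
Context {W : topologicalType} (H : W * R -> Y) (F0 : W -> E).
Hypotheses (cH : continuous H) (cF0 : continuous F0)
  (pF0 : forall w, p (F0 w) = H (w, 0)).

(** The lift K is required to be continuous on all of N x R, although it lifts H
    only up to time s: such maps can be pasted without boundary conditions. *)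
Definition lifted_near (w0 : W) (s : R) : Prop := exists N (K : W * R -> E),
  [/\ open N, N w0, forall w, N w -> K (w, 0) = F0 w,
      forall w x, N w -> {for (w, x), continuous K} &
      forall w x, N w -> 0 <= x <= s -> p (K (w, x)) = H (w, x)].

Lemma lifted_near_mono w0 s s' : s' <= s -> lifted_near w0 s ->
  lifted_near w0 s'.
Proof.
move=> ss' [N [K [oN Nw0 K0 cK pK]]]; exists N, K; split => // w x Nw xs.
by apply: pK => //; lra.
Qed.

(** Near (w0, s) the homotopy H takes its values in the domain of a section of
    p. A deck transformation g makes the section agree with K at time s', first
    at w0 and then on a neighbourhood of w0, and the two are pasted there. *)
Lemma lifted_near_step w0 s : 0 <= s -> exists2 d : R, 0 < d &
  forall s', 0 <= s' -> s - d < s' -> s' <= s -> lifted_near w0 s' ->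
    lifted_near w0 (s + d).
Proof.
move=> s0; have [e0 pe0] := dc_surj dc (H (w0, s)).
have [V [sigma [oV Ve0 csig psig]]] := local_section e0.
rewrite pe0 in Ve0.
have [[N1 B] /= [N1w0 Bs] NB] : nbhs (w0, s) (H @^-1` V).
  by apply: cH; exact: open_nbhs_nbhs.
have [d /= d0 dB] := Bs.
exists (d / 2); first by rewrite divr_gt0.
move=> s' s'0 ds' s's [N [K [oN Nw0 K0 cK pK]]].
have VH w x : N1 w -> `|x - s| < d -> V (H (w, x)).
  move=> N1w xs; apply: (NB (w, x)); split => //.
  by apply: dB; rewrite /= distrC.
have VHs' w : N1 w -> V (H (w, s')).
  by move=> N1w; apply: VH => //; rewrite ltr_norml; apply/andP; split; lra.
have cH2 w (phi : R -> R) x : continuous phi ->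
    {for (w, x), continuous (fun z : W * R => H (z.1, phi z.2))}.
  move=> cphi; apply: (continuous_cmp cH).
  apply: continuous_pair; first exact: fst_continuous.
  exact: (continuous_cmp cphi (@snd_continuous _ _)).
have N1w0' : N1 w0 by exact: nbhs_singleton.
have [g Gg gK] : exists2 g, G g & g (sigma (H (w0, s'))) = K (w0, s').
  by apply: (dc_trans dc); rewrite psig ?pK ?s'0 ?lexx//; exact: VHs'.
have cs' : continuous (fun w : W => (w, s')) by ctn.
have near_g : \forall w \near w0, K (w, s') = g (sigma (H (w, s'))).
  apply: (lifts_near (f := fun w => sigma (H (w, s')))) => //.
  - apply: (@continuous_comp _ _ _ (fun w => H (w, s')) sigma).
      by apply: (continuous_cmp cH); ctn.
    by apply: csig; exact: VHs'.
  - apply: (@continuous_comp _ _ _ (fun w => (w, s')) K); last exact: cK.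
    exact: cs'.
  - near=> w; rewrite psig; last by apply: VHs'; near: w.
    rewrite pK ?s'0 ?lexx//.
    by near: w; exact: open_nbhs_nbhs.
(* trunc keeps the second half inside the domain of sigma at all times *)
pose trunc (x : R) := Num.max s' (Num.min x (s + d / 2)).
have ctrunc : continuous trunc.
  apply: continuous_fmax; first exact: cst_continuous.
  by apply: continuous_fmin; [move=> ?; exact: cvg_id|exact: cst_continuous].
have truncP x : `|trunc x - s| < d.
  have : s' <= trunc x by rewrite le_max lexx.
  have : trunc x <= s + d / 2 by rewrite ge_max ge_min lexx orbT andbT; lra.
  by move=> ? ?; rewrite ltr_norml; apply/andP; split; lra.
have Nnear : \forall w \near w0,
    [/\ N w, N1 w & K (w, s') = g (sigma (H (w, s')))].
  near=> w; split; near: w => //.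
  exact: open_nbhs_nbhs.
exists [set w | N w /\ N1 w /\ K (w, s') = g (sigma (H (w, s')))]°.
exists (fun z => if z.2 <= s' then K z else g (sigma (H (z.1, trunc z.2)))).
have sub := @interior_subset _ [set w | N w /\ N1 w /\
  K (w, s') = g (sigma (H (w, s')))].
split.
- exact: open_interior.
- by apply: filterS Nnear => w [].
- by move=> w /sub [Nw _] /=; rewrite s'0 K0.
- move=> w x /sub [Nw [N1w gE]]; apply: paste_at.
  + exact: snd_continuous.
  + exact: cK.
  + apply: continuous_comp; last exact: (dc_deck_continuous dc Gg).
    apply: (@continuous_comp _ _ _ (fun z => H (z.1, trunc z.2)) sigma).
      exact: cH2.
    by apply: csig; exact: VH.
  + move=> /= ->; rewrite gE; congr (g (sigma (H (w, _)))).
    by rewrite /trunc max_l// ge_min lexx.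
- move=> w x /sub [Nw [N1w gE]] /= /andP[x0 xs]; case: ifPn => [xs'|].
    by rewrite pK ?x0.
  rewrite -ltNge => s'x; rewrite (dc_deck dc _ Gg) psig; last exact: VH.
  by rewrite /trunc min_l// max_r// ltW.
Unshelve. all: by end_near. Qed.

(** By lifted_near_step the supremum of the times that are reached is reached
    and cannot be less than 1. *)
Lemma lifted_near1 w0 : lifted_near w0 1.
Proof.
pose S := [set s : R | 0 <= s <= 1 /\ lifted_near w0 s].
have S0 : S 0.
  rewrite /S /= lexx ler01; split => //.
  exists setT, (fun z => F0 z.1); split => //.
  - exact: openT.
  - by move=> w x _; apply: (continuous_cmp cF0); exact: fst_continuous.
  - move=> w x _ x0; rewrite (_ : x = 0) ?pF0//; apply/eqP.
    by rewrite eq_le andbC.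
have hS : has_sup S by split; [exists 0|exists 1 => s [/andP[]]].
have s0 : 0 <= sup S by apply: sup_upper_bound.
have [d d0 step] := lifted_near_step w0 s0.
have [s' Ss' s's] := sup_adherent d0 hS; have [/andP[s'0 _] L] := Ss'.
have s'le : s' <= sup S by exact: sup_upper_bound.
have Ld := step s' s'0 s's s'le L.
have [|lt1] := leP 1 (sup S + d); first by move=> /lifted_near_mono; exact.
have : sup S + d <= sup S.
  by apply: sup_upper_bound => //; split => //; apply/andP; split; lra.
by lra.
Qed.

(** Lifts of the tubes around the various points of W agree on overlaps by
    uniqueness of path lifting, so they define one continuous map. *)
Lemma homotopy_lifting : exists K : W * R -> E,
  [/\ continuous K, forall w, K (w, 0) = F0 w &
      forall w x, 0 <= x <= 1 -> p (K (w, x)) = H (w, x)].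
Proof.
have /choice[N /choice[K KP]] := lifted_near1.
pose cl (x : R) := ival (clamp x).
have ccl : continuous cl.
  exact: (continuous_cmp (@ival_continuous R) (@clamp_continuous R)).
have cl0 : cl 0 = 0 by exact: ival0.
have clP x : 0 <= cl x <= 1 by rewrite ival_ge0 ival_le1.
have ccl1 : continuous (fun z : W * R => (z.1, cl z.2)) by ctn.
have ccl2 w : continuous (fun x => (w : W, cl x)) by ctn.
have glue v w : N v w -> forall x, K v (w, cl x) = K w (w, cl x).
  move=> Nvw; have [_ _ K0 cK pK] := KP v; have [_ Nw K0' cK' pK'] := KP w.
  apply: (@path_lift_unique _ _ _ _ _ 0).
  - by move=> x; apply: continuous_comp; [exact: ccl2|exact: cK].
  - by move=> x; apply: continuous_comp; [exact: ccl2|exact: cK'].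
  - by move=> x; rewrite pK// pK'.
  - by rewrite cl0 K0// K0'.
exists (fun z => K z.1 (z.1, cl z.2)); split.
- move=> [w x]; have [oN Nw K0 cK pK] := KP w.
  apply: (@eq_near_at _ _ (fun z => K w (z.1, cl z.2))).
    have : \forall z \near (w, x), N w z.1.
      by apply: (@fst_continuous W R (w, x)); exact: open_nbhs_nbhs.
    by apply: filterS => z /= Nz; exact: (glue _ _ Nz).
  apply: (@continuous_comp _ _ _ (fun z => (z.1, cl z.2)) (K w)).
    exact: ccl1.
  exact: cK.
- by move=> w /=; have [_ Nw K0 _ _] := KP w; rewrite cl0 K0.
- move=> w x /andP[x0 x1] /=; have [_ Nw _ _ pK] := KP w.
  by rewrite pK// /cl clampK// x0 x1.
Qed.

End HomotopyLifting.

Section Contractible.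
Context {W : topologicalType} (w0 : W) (c : W * R -> W).
Hypotheses (cc : continuous c) (c0 : forall w, c (w, 0) = w0)
  (c1 : forall w, c (w, 1) = w) (cw0 : forall x, c (w0, x) = w0).

(** Lift the homotopy from the constant map to f given by the contraction c. *)
Lemma lift_exists (f : W -> Y) (e0 : E) : continuous f -> p e0 = f w0 ->
  exists F : W -> E, [/\ continuous F, F w0 = e0 & forall w, p (F w) = f w].
Proof.
move=> cf pe0.
have [K [cK K0 pK]] := @homotopy_lifting W (f \o c) (fun=> e0)
  (continuous_cmp cf cc) (@cst_continuous _ _ e0) (fun w =>
  etrans pe0 (congr1 f (esym (c0 w)))).
exists (fun w => K (w, 1)); split.
- by ctn.
- have ccl : continuous (fun x => ival (clamp x) : R).
    exact: (continuous_cmp (@ival_continuous R) (@clamp_continuous R)).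
  have := @path_lift_unique (fun x => K (w0, ival (clamp x))) (fun=> e0) _ _ _ 0
    _ 1.
  rewrite /= ival0 ival1; apply => //.
  + by ctn.
  + by ctn.
  + by move=> x; rewrite pK /= ?cw0 ?pe0// ival_ge0 ival_le1.
- by move=> w; rewrite pK ?lexx ?ler01//= c1.
Qed.

Lemma lifts_deck (f f' : W -> E) : continuous f -> continuous f' ->
  (forall w, p (f w) = p (f' w)) -> exists2 g, G g & forall w, f' w = g (f w).
Proof.
move=> cf cf' pf; have [g Gg gE] := dc_trans dc (pf w0).
have cpath w : continuous (fun x => c (w, x)) by ctn.
exists g => // w.
have [h Gh hE] := path_lifts_deck (continuous_cmp cf (cpath w))
  (continuous_cmp cf' (cpath w)) (fun x => pf _).
by rewrite -(c1 w) (@dc_free dc g h (f w0))// gE -(c0 w) hE.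
Qed.

End Contractible.

End Covering.

(** * The universal covering of the bundle of a shear *)

Section UniversalCover.
Context {R : realType}.
Notation E := (R * R * R)%type.

Definition act (k : int) (g : int * int * int) (e : E) : E :=
  (e.1.1 + (k * g.2)%:~R * e.1.2 + g.1.1%:~R, e.1.2 + g.1.2%:~R,
   e.2 + g.2%:~R).

(** The group law of the deck group: the Heisenberg group with commutator
    [c, b] = a^k. *)
Definition gmul (k : int) (g h : int * int * int) : int * int * int :=
  (g.1.1 + k * g.2 * h.1.2 + h.1.1, g.1.2 + h.1.2, g.2 + h.2).

Definition ginv (k : int) (g : int * int * int) : int * int * int :=
  (k * g.2 * g.1.2 - g.1.1, - g.1.2, - g.2).

Lemma act_mul k g h e : act k g (act k h e) = act k (gmul k g h) e.
Proof.
by rewrite /act /gmul /=; congr (_, _, _); rewrite ?intrD ?intrM; ring.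
Qed.

Lemma act1 k e : act k (0, 0, 0) e = e.
Proof. by case: e => -[x y] t; rewrite /act /= mulr0 mul0r !addr0. Qed.

Lemma actK k g : cancel (act k g) (act k (ginv k g)).
Proof.
move=> e; rewrite act_mul -[RHS](act1 k); congr act.
by rewrite /gmul /ginv /=; congr (_, _, _); ring.
Qed.

Lemma actVK k g : cancel (act k (ginv k g)) (act k g).
Proof.
move=> e; rewrite act_mul -[RHS](act1 k); congr act.
by rewrite /gmul /ginv /=; congr (_, _, _); ring.
Qed.

Lemma act_inj k g h e : act k g e = act k h e -> g = h.
Proof.
case: g => -[a b] n; case: h => -[a' b'] n' [].
move=> xx /addrI/intr_inj -> /addrI/intr_inj nn; rewrite nn in xx *.
by move: xx => /addrI/intr_inj ->.
Qed.

Lemma act_continuous k g : continuous (act k g).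
Proof. by rewrite /act; ctn. Qed.

Definition same_orbit (k : int) (e e' : E) : Prop := exists g, act k g e = e'.

Lemma same_orbit_refl k e : same_orbit k e e.
Proof. by exists (0, 0, 0); rewrite act1. Qed.

Lemma same_orbit_sym k e e' : same_orbit k e e' -> same_orbit k e' e.
Proof. by move=> [g <-]; exists (ginv k g); rewrite actK. Qed.

Lemma same_orbit_trans k e e' e'' :
  same_orbit k e e' -> same_orbit k e' e'' -> same_orbit k e e''.
Proof. by move=> [g <-] [h <-]; exists (gmul k h g); rewrite act_mul. Qed.

Lemma tor_translate (x y : R) (a b : int) :
  tor (x + a%:~R) (y + b%:~R) = tor x y.
Proof.
by apply: (@glued_eq _ (@torus_rel R)); split => /=; rewrite addrAC subrr add0r.
Qed.

Lemma tor_eq (x y x' y' : R) : tor x y = tor x' y' ->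
  exists a b : int, x' = x + a%:~R /\ y' = y + b%:~R.
Proof.
pose s (u v : R * R) :=
  exists a b : int, v.1 = u.1 + a%:~R /\ v.2 = u.2 + b%:~R.
have sP : tor x y = tor x' y' -> s (x, y) (x', y').
  apply: glued_class.
  - move=> [x1 y1] [x2 y2] [/intrP[a /= ea] /intrP[b /= eb]].
    exists (- a), (- b); rewrite !intrN -ea -eb.
    by split => /=; ring.
  - by move=> u; exists 0, 0; rewrite !addr0.
  - move=> u v [a [b [e1 e2]]]; exists (- a), (- b).
    by rewrite e1 e2 !intrN !addrK.
  - move=> u v w [a [b [e1 e2]]] [a' [b' [e3 e4]]].
    by exists (a + a'), (b + b'); rewrite e3 e4 e1 e2 !intrD !addrA.
exact: sP.
Qed.

Lemma tor_surj (q : torus R) : exists x y, q = tor x y.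
Proof.
by exists (repr q).1, (repr q).2; rewrite /tor -surjective_pairing reprK.
Qed.

Lemma tor_open : open_map (fun v : R * R => tor v.1 v.2).
Proof.
split=> U oU; apply: open_glued.
rewrite (_ : _ @^-1` _ = \bigcup_(n : int * int)
  (fun v : R * R => (v.1 + n.1%:~R, v.2 + n.2%:~R)) @^-1` U).
  apply: bigcup_open => n _; move: U oU; apply/continuousP.
  by ctn.
apply/seteqP; split => -[x y].
  move=> [[x' y'] Ue] /= /esym.
  rewrite (_ : \pi_(torus R) (x, y) = tor x y)// => /tor_eq[a [b [ex ey]]].
  by exists (a, b) => //=; rewrite -ex -ey.
move=> [[a b] _ Un]; exists (x + a%:~R, y + b%:~R) => //=.
exact: tor_translate.
Qed.

Lemma torus_map_shear k (x y : R) :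
  torus_map (mx2 1 k 0 1) (tor x y) = tor (x + k%:~R * y) y.
Proof. by rewrite torus_mapE !mxE /=; congr tor; ring. Qed.

Definition sheet (k m : int) (e : E) : torus_bundle R (mx2 1 k 0 1) :=
  bpt _ (tor (e.1.1 - (k * m)%:~R * e.1.2) e.1.2) (clamp (e.2 - m%:~R)).

(** The universal covering R^3 -> M_k, where M_k is the bundle of the shear
    (x, y) |-> (x + k y, y): in the slab m <= t <= m + 1 the torus coordinates
    are sheared back m times, which makes the slabs fit together. *)
Definition uc (k : int) (e : E) : torus_bundle R (mx2 1 k 0 1) :=
  sheet k (Num.floor e.2) e.

(** At the common boundary of two slabs the gluing map of the bundle
    compensates the difference of one shear. *)
Lemma sheet_glue k m (e : E) : e.2 = m%:~R -> sheet k (m - 1) e = sheet k m e.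
Proof.
move=> em; rewrite /sheet em subrr.
have -> : m%:~R - (m - 1)%:~R = 1 :> R by rewrite intrB; ring.
rewrite [RHS]bpt_glue torus_map_shear; congr (bpt _ (tor _ _) _).
by rewrite !intrM intrB; ring.
Qed.

Lemma ucE k m (e : E) : m%:~R <= e.2 <= m%:~R + 1 -> uc k e = sheet k m e.
Proof.
move=> /andP[me]; rewrite le_eqVlt => /orP[/eqP em|em].
  have em' : e.2 = (m + 1)%:~R by rewrite intrD.
  rewrite /uc em' intrKfloor -sheet_glue//; first by rewrite addrK.
by rewrite /uc (floor_def (m := m))// me intrD.
Qed.

Lemma uc_bpt k (x y : R) (t : I01 R) : uc k (x, y, ival t) = bpt _ (tor x y) t.
Proof.
rewrite (@ucE k 0); last by rewrite add0r ival_ge0 ival_le1.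
by rewrite /sheet /= mulr0 mul0r !subr0 ivalK.
Qed.

Lemma uc_bpt0 k (x y : R) : uc k (x, y, 0) = bpt _ (tor x y) zero.
Proof. by rewrite -(uc_bpt k x y zero) ival0. Qed.

Lemma uc_base k : uc k (0, 0, 0) = @bbase R _.
Proof. exact: uc_bpt0. Qed.

Lemma uc_act k g e : uc k (act k g e) = uc k e.
Proof.
rewrite /uc /= floorDrz ?intr_int// intrKfloor /sheet /=.
set m := Num.floor _; case: g => -[a b] n /=.
rewrite -(tor_translate (e.1.1 - (k * m)%:~R * e.1.2) e.1.2
  (a - k * (m + n) * b) b).
by congr (bpt _ (tor _ _) (clamp _)); rewrite ?intrD ?intrN ?intrM ?intrD; ring.
Qed.

Lemma bpt_eq k (q q' : torus R) t t' :
  bpt (mx2 1 k 0 1) q t = bpt _ q' t' -> exists x y x' y',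
  [/\ q = tor x y, q' = tor x' y' &
      same_orbit k (x, y, ival t) (x', y', ival t')].
Proof.
pose s (z w : torus R * I01 R) := exists x y x' y', [/\ z.1 = tor x y,
  w.1 = tor x' y' & same_orbit k (x, y, ival z.2) (x', y', ival w.2)].
move=> h; suff : s (q, t) (q', t') by [].
apply: (glued_class _ _ _ _ h) => {h q q' t t'}.
- move=> [q t] [q' t'] [/= -> [-> ->]]; have [x [y qE]] := tor_surj q.
  exists x, y, (x + k%:~R * y), y; rewrite qE /= torus_map_shear; split => //.
  exists (0, 0, 1); rewrite /act /= ival0 ival1 mulr1.
  by congr (_, _, _); ring.
- move=> [q t]; have [x [y qE]] := tor_surj q.
  by exists x, y, x, y; split => //; exact: same_orbit_refl.
- move=> z w [x [y [x' [y' [? ? /same_orbit_sym ?]]]]].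
  by exists x', y', x, y.
- move=> u z w [x [y [x' [y' [e1 e2 o1]]]]] [x1 [y1 [x1' [y1' [e3 e4 o2]]]]].
  exists x, y, x1', y1'; split => //; apply: (same_orbit_trans o1).
  apply: same_orbit_trans o2.
  have /tor_eq[a [b [-> ->]]] : tor x' y' = tor x1 y1 by rewrite -e2.
  by exists (a, b, 0); rewrite /act /= mulr0 mul0r !addr0.
Qed.

Lemma uc_fibre k e e' : uc k e = uc k e' -> same_orbit k e e'.
Proof.
have sheetO (f : E) (x y : R) :
    tor (f.1.1 - (k * Num.floor f.2)%:~R * f.1.2) f.1.2 = tor x y ->
    same_orbit k f (x, y, f.2 - (Num.floor f.2)%:~R).
  move=> /tor_eq[a [b [-> ->]]]; exists (a, b, - Num.floor f.2).
  by rewrite /act /=; congr (_, _, _); rewrite ?intrM ?intrN; ring.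
have ivalE (f : E) :
    ival (clamp (f.2 - (Num.floor f.2)%:~R)) = f.2 - (Num.floor f.2)%:~R.
  by apply: clampK; have := floor_itv f.2; rewrite intrD; lra.
move=> /bpt_eq[x [y [x' [y' [/sheetO oe /sheetO oe' o]]]]].
rewrite !ivalE in o.
exact: same_orbit_trans oe (same_orbit_trans o (same_orbit_sym oe')).
Qed.

Lemma uc_surj k z : exists e, uc k e = z.
Proof.
have [x [y qE]] := tor_surj (repr z).1; exists (x, y, ival (repr z).2).
by rewrite uc_bpt -qE /bpt -surjective_pairing reprK.
Qed.

Lemma uc_continuous k : continuous (uc k).
Proof.
have csheet m : continuous (sheet k m).
  have ct : continuous (fun e : E => tor (e.1.1 - (k * m)%:~R * e.1.2) e.1.2).
    have cf : continuous (fun e : E => (e.1.1 - (k * m)%:~R * e.1.2, e.1.2)).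
      by ctn.
    exact: (continuous_cmp (@tor_continuous R) cf).
  have cc : continuous (fun e : E => clamp (e.2 - m%:~R)).
    by apply: (continuous_cmp (@clamp_continuous _)); ctn.
  exact: (continuous_cmp (@bpt_continuous R (mx2 1 k 0 1))
    (continuous_pair ct cc)).
move=> e; pose m := Num.floor (e.2 + 2^-1).
have /andP[m1 m2] : m%:~R <= e.2 + 2^-1 < m%:~R + 1.
  by have := floor_itv (e.2 + 2^-1); rewrite intrD.
suff : {for e, continuous (uc k)} by [].
pose F (e : E) := if e.2 <= m%:~R then sheet k (m - 1) e else sheet k m e.
refine (@eq_near_at _ _ F (uc k) e _ _).
  have lo : \forall e' \near e, m%:~R - 1 < e'.2.
    have me : m%:~R - 1 < e.2 by lra.
    exact: (@snd_continuous _ _ e _ (lt_nbhsr me)).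
  have hi : \forall e' \near e, e'.2 < m%:~R + 1.
    have me : e.2 < m%:~R + 1 by lra.
    exact: (@snd_continuous _ _ e _ (lt_nbhsl me)).
  near=> e'; rewrite /F.
  have lo' : m%:~R - 1 < e'.2 by near: e'.
  have hi' : e'.2 < m%:~R + 1 by near: e'.
  case: ifPn => [le|]; first by rewrite (@ucE _ (m - 1))// intrB; lra.
  by rewrite -ltNge => lt; rewrite (@ucE _ m)//; lra.
apply: paste_at; [exact: snd_continuous|exact: csheet|exact: csheet|].
exact: sheet_glue.
Unshelve. all: by end_near. Qed.

(** The preimage in T^2 x [0, 1] of the image of U is the image of the union of
    the translates of U. *)
Lemma uc_open k : open_map (uc k).
Proof.
split=> U oU; apply: open_glued; rewrite openE => -[q t] [e Ue ez].
have [x [y qE]] := tor_surj q.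
have : uc k e = uc k (x, y, ival t) by rewrite uc_bpt -qE.
move=> /uc_fibre/same_orbit_sym[g gE].
have : nbhs (x, y, ival t) (act k g @^-1` U).
  by apply: act_continuous; rewrite gE; exact: open_nbhs_nbhs.
move=> [[A B] /= [Axy Bt] AB].
exists ((fun v : R * R => tor v.1 v.2) @` A°, @ival R @^-1` B) => /=.
  split.
    apply: open_nbhs_nbhs; split.
      by apply: (open_image tor_open); exact: open_interior.
    by exists (x, y) => //; exact: nbhs_singleton (nbhs_interior Axy).
  exact: ival_continuous.
move=> [_ t'] /= [[[x' y'] /interior_subset Axy' <-] Bt'].
exists (act k g (x', y', ival t')); first by apply: AB.
by rewrite uc_act uc_bpt.
Qed.

Lemma int_small (c : int) : -1 < (c%:~R : R) < 1 -> c = 0.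
Proof. by rewrite -(intrN _ 1) -[1]/(1%:~R) !ltr_int => /andP[? ?]; lia. Qed.

(** Points of one fibre in a box of side 1/2 have the same t, because their
    heights differ by an integer; then the same y, and then the same x. *)
Lemma uc_locally_injective k e :
  exists U, open_nbhs e U /\ {in U &, injective (uc k)}.
Proof.
exists (ball e (4^-1))°; split.
  split; first exact: open_interior.
  apply: nbhs_singleton; apply: nbhs_interior.
  by apply: nbhsx_ballx; rewrite invr_gt0.
move=> [[x y] t] [[x' y'] t'] /set_mem/interior_subset[[/= bx by_] bt].
move=> /set_mem/interior_subset[[/= bx' by_'] bt'] /uc_fibre[[[a b] n]].
move: e bx by_ bt bx' by_' bt' => [[x0 y0] t0] /=.
rewrite /ball /= !ltr_norml => bx by_ bt bx' by_' bt' [ex ey et].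
have n0 : n = 0 by apply: int_small; lra.
have b0 : b = 0 by apply: int_small; lra.
have a0 : a = 0 by apply: int_small; move: ex; rewrite n0 mulr0 mul0r; lra.
move: ex ey et; rewrite n0 b0 a0 mulr0 mul0r !addr0.
by move=> -> -> ->.
Qed.

Definition deck_group (k : int) : set (E -> E) := [set act k g | g in setT].

Lemma uc_covering k : deck_covering (uc k) (deck_group k).
Proof.
split.
- exact: uc_continuous.
- exact: uc_open.
- exact: uc_surj.
- by move=> _ [g _ <-]; exact: act_continuous.
- by move=> _ e [g _ <-]; exact: uc_act.
- by move=> e e' /uc_fibre[g <-]; exists (act k g) => //; exists g.
- by move=> _ _ e [g _ <-] [h _ <-] /act_inj ->.
- exact: uc_locally_injective.
Qed.

Definition scale (z : E * R) : E := (z.2 * z.1.1.1, z.2 * z.1.1.2, z.2 * z.1.2).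

Lemma scale_continuous : continuous scale.
Proof. by rewrite /scale; ctn. Qed.

Lemma scale0 e : scale (e, 0) = (0, 0, 0).
Proof. by rewrite /scale /= !mul0r. Qed.

Lemma scale1 e : scale (e, 1) = e.
Proof. by case: e => -[x y] t; rewrite /scale /= !mul1r. Qed.

Lemma scale_base r : scale ((0, 0, 0), r) = (0, 0, 0).
Proof. by rewrite /scale /= !mulr0. Qed.

Section SpaceLifts.
Context {Y : topologicalType} (p : E -> Y) (G : set (E -> E)).
Hypothesis dc : deck_covering p G.

Lemma space_lift (f : E -> Y) (e0 : E) : continuous f -> p e0 = f (0, 0, 0) ->
  exists F : E -> E,
    [/\ continuous F, F (0, 0, 0) = e0 & forall e, p (F e) = f e].
Proof. exact: (lift_exists dc scale_continuous scale0 scale1 scale_base). Qed.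

Lemma space_lifts_deck (f f' : E -> E) : continuous f -> continuous f' ->
  (forall e, p (f e) = p (f' e)) -> exists2 g, G g & forall e, f' e = g (f e).
Proof. exact: (lifts_deck dc scale_continuous scale0 scale1). Qed.

End SpaceLifts.

Lemma uc_lift k (f : E -> torus_bundle R (mx2 1 k 0 1)) : continuous f ->
  exists F : E -> E, continuous F /\ forall e, uc k (F e) = f e.
Proof.
move=> cf; have [e0 e0E] := uc_surj (f (0, 0, 0)).
by have [F [cF _ FE]] := space_lift (uc_covering k) cf e0E; exists F.
Qed.

Lemma uc_lifts k (f f' : E -> E) : continuous f -> continuous f' ->
  (forall e, uc k (f e) = uc k (f' e)) ->
  exists g, forall e, f' e = act k g (f e).
Proof.
move=> cf cf' ff'.
have [_ [g _ <-] gE] := space_lifts_deck (uc_covering k) cf cf' ff'.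
by exists g.
Qed.

End UniversalCover.
(** * Lifts of maps over the circle *)

Lemma int_updown (P : int -> Prop) : P 0 -> (forall n, P n -> P (n + 1)) ->
  (forall n, P n -> P (n - 1)) -> forall n, P n.
Proof.
move=> P0 Pu Pd; elim/int_rect => [//|n /Pu|n /Pd].
  by rewrite -PoszD addn1.
by rewrite -opprD -PoszD addn1.
Qed.

Section GroupLaw.
Context (k : int) (S : set (int * int * int)).
Hypotheses (SM : forall g h, S g -> S h -> S (gmul k g h))
  (SV : forall g, S g -> S (ginv k g)).

Lemma gpow_mem (g : int * int * int) (pw : int -> int * int * int) :
  S g -> pw 0 = (0, 0, 0) -> (forall n, pw (n + 1) = gmul k (pw n) g) ->
  forall n, S (pw n).
Proof.
move=> Sg pw0 pwS; apply: int_updown => [|n Sn|n Sn].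
- rewrite pw0 (_ : (0, 0, 0) = gmul k g (ginv k g)); first exact/SM/SV.
  case: g {Sg pwS} => -[a b] n; rewrite /gmul /ginv /=.
  by congr (_, _, _); ring.
- by rewrite pwS; exact: SM.
- have -> : pw (n - 1) = gmul k (pw n) (ginv k g).
    rewrite -[in RHS](subrK 1 n) pwS.
    case: (pw _) => -[a b] m; case: g {Sg pwS} => -[a' b'] m'.
    by rewrite /gmul /ginv /=; congr (_, _, _); ring.
  by apply: SM => //; exact: SV.
Qed.

(** This is the product of the i-th, b-th and n-th powers of the three given
    elements. *)
Lemma gen_mem (d e2 e3 : int) : S (d, 0, 0) -> S (e2, 1, 0) -> S (e3, 0, 1) ->
  forall i b n, S (d * i + e2 * b + e3 * n, b, n).
Proof.
move=> Sa Sb Sc i b n.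
have Sai := gpow_mem (pw := fun i => (d * i, 0, 0)) Sa _ _ i.
have Sbb := gpow_mem (pw := fun b => (e2 * b, b, 0)) Sb _ _ b.
have Scn := gpow_mem (pw := fun n => (e3 * n, 0, n)) Sc _ _ n.
rewrite (_ : (_, _, _) =
  gmul k (gmul k (d * i, 0, 0) (e2 * b, b, 0)) (e3 * n, 0, n)); last first.
  by rewrite /gmul /=; congr (_, _, _); ring.
apply: SM; first (apply: SM; [apply: Sai|apply: Sbb]); last apply: Scn.
all: by move=> *; rewrite /gmul /= ?mulr0//; congr (_, _, _); ring.
Qed.

End GroupLaw.

Section Lifts.
Context {R : realType}.
Notation E := (R * R * R)%type.
Notation A := (mx2 1 1 0 1).
Notation MA := (torus_bundle R A).

Lemma circle_eq (s t : I01 R) : \pi_(circle R) s = \pi_(circle R) t ->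
  exists n : int, ival t = ival s + n%:~R.
Proof.
apply: (glued_class
  (s := fun s t : I01 R => exists n : int, ival t = ival s + n%:~R)).
- by move=> _ _ [-> ->]; exists 1; rewrite ival0 ival1 add0r.
- by move=> x; exists 0; rewrite addr0.
- by move=> x y [n ->]; exists (- n); rewrite intrN addrK.
- by move=> x y z [n e1] [m e2]; exists (n + m); rewrite e2 e1 intrD addrA.
Qed.

Lemma bproj_uc k (e : E) :
  bproj (uc k e) = \pi_(circle R) (clamp (e.2 - (Num.floor e.2)%:~R)).
Proof. exact: bprojE. Qed.

Lemma bproj_uc_eq k k' (e e' : E) : bproj (uc k e) = bproj (uc k' e') ->
  exists n : int, e'.2 = e.2 + n%:~R.
Proof.
rewrite !bproj_uc => /circle_eq[n].
rewrite !clampK; try by have := floor_itv e.2; have := floor_itv e'.2;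
  rewrite !intrD; lra.
move=> h; exists (Num.floor e'.2 - Num.floor e.2 + n).
by rewrite !intrD intrN; lra.
Qed.

(** (u, 0, 0) lifts the constant map at the base point, because u is integer
    valued; so it differs from the constant lift by a single deck
    transformation. *)
Lemma int_valued_cst (u : E -> R) : continuous u ->
  (forall e, exists n : int, u e = n%:~R) ->
  exists n : int, forall e, u e = n%:~R.
Proof.
move=> cu uint.
have [||e|g gE] := @uc_lifts R 1 (fun=> (0, 0, 0)) (fun e => (u e, 0, 0)).
- by ctn.
- by ctn.
- have [n ->] := uint e; rewrite -(uc_act 1 (n, 0, 0) (0, 0, 0)).
  by congr uc; rewrite /act /= mulr0 !addr0 add0r.
- by exists g.1.1 => e; have [-> _ _] := gE e; rewrite /= mulr0 !add0r.
Qed.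

(** A lift of a map over the circle, normalised to preserve the height, acts
    on the deck group by (a, b) |-> (r a + s b, r b) on the fibre: it has to
    commute with the shear, hence is itself triangular with equal diagonal
    entries. *)
Record level_lift (F : E -> E) (r s m1 m2 : int) : Prop := LevelLift {
  ll_continuous : continuous F;
  ll_level : forall e, (F e).2 = e.2;
  ll_fibre : forall a b e,
    F (act 1 (a, b, 0) e) = act 1 (r * a + s * b, r * b, 0) (F e);
  ll_base : forall e, F (act 1 (0, 0, 1) e) = act 1 (m1, m2, 1) (F e) }.

Lemma act_fibre k (a b : int) (e : E) :
  act k (a, b, 0) e = (e.1.1 + a%:~R, e.1.2 + b%:~R, e.2).
Proof. by rewrite /act /= mulr0 mul0r !addr0. Qed.

Lemma level_lift_fibre (F : E -> E) (r s : int) :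
  (forall e, F (act 1 (1, 0, 0) e) = act 1 (r, 0, 0) (F e)) ->
  (forall e, F (act 1 (0, 1, 0) e) = act 1 (s, r, 0) (F e)) ->
  forall a b e, F (act 1 (a, b, 0) e) = act 1 (r * a + s * b, r * b, 0) (F e).
Proof.
move=> F1 F2.
pose S (g : int * int * int) := g.2 = 0 /\
  forall e, F (act 1 g e) = act 1 (r * g.1.1 + s * g.1.2, r * g.1.2, 0) (F e).
have SM g h : S g -> S h -> S (gmul 1 g h).
  move=> [g0 gE] [h0 hE]; split; first by rewrite /= g0 h0.
  move=> e; rewrite -act_mul gE hE act_mul /gmul /= g0.
  by congr act; congr (_, _, _); ring.
have SV g : S g -> S (ginv 1 g).
  move=> [g0 gE]; split; first by rewrite /= g0 oppr0.
  move=> e; have := gE (act 1 (ginv 1 g) e); rewrite actVK.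
  move=> /(congr1 (act 1 (ginv 1 (r * g.1.1 + s * g.1.2, r * g.1.2, 0)))).
  rewrite actK => <-; rewrite /ginv /= g0.
  by congr act; congr (_, _, _); ring.
have S1 : S (1, 0, 0) by split => // e; rewrite F1 /= !mulr0 mulr1 !addr0.
have S2 : S (0, 1, 0) by split => // e; rewrite F2 /= !mulr0 !mulr1 !add0r.
have Sa a := gpow_mem SM SV (pw := fun a => (a, 0, 0)) S1.
have Sb b := gpow_mem SM SV (pw := fun b => (0, b, 0)) S2.
move=> a b e.
suff [_ ab] : S (a, b, 0) by exact: ab.
rewrite (_ : (a, b, 0) = gmul 1 (a, 0, 0) (0, b, 0)); last first.
  by rewrite /gmul /=; congr (_, _, _); ring.
apply: SM; [apply: Sa|apply: Sb] => //.
all: by move=> n; rewrite /gmul /= ?mulr0 ?mul0r !addr0.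
Qed.

(** The heights of F0 and of the identity differ by an integer constant, so a
    power of c corrects the lift. Then the relations alpha c = c alpha and
    c beta = alpha beta c are transported by F. *)
Lemma over_lift (f : MA -> MA) : continuous f ->
  (forall z, bproj (f z) = bproj z) ->
  exists F r s m1 m2,
    level_lift F r s m1 m2 /\ forall e, uc 1 (F e) = f (uc 1 e).
Proof.
move=> cf pf.
have [F0 [cF0 F0E]] := uc_lift (continuous_cmp cf (@uc_continuous R 1)).
have [n nE] : exists n : int, forall e, e.2 - (F0 e).2 = n%:~R.
  apply: int_valued_cst; first by ctn.
  move=> e; have [|n nE] := @bproj_uc_eq 1 1 (F0 e) e; first by rewrite F0E pf.
  by exists n; rewrite nE addrC addKr.
pose F e := act 1 (0, 0, n) (F0 e).
have cF : continuous F := continuous_cmp (@act_continuous R 1 (0, 0, n)) cF0.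
have FE e : uc 1 (F e) = f (uc 1 e) by rewrite uc_act F0E.
have lF e : (F e).2 = e.2 by rewrite /= -(nE e) subrKC.
clearbody F.
have deck g : exists a b, forall e, F (act 1 g e) = act 1 (a, b, g.2) (F e).
  have [||e|[[a b] m] hE] := @uc_lifts R 1 F (F \o act 1 g) => //.
  - by apply: (continuous_cmp cF); exact: act_continuous.
  - by rewrite /= !FE uc_act.
  exists a, b => e; rewrite (_ : g.2 = m); first exact: hE.
  have : (F (act 1 g e)).2 = (F e).2 + m%:~R := congr1 snd (hE e).
  by rewrite !lF /= => /addrI/intr_inj.
have [r [r' rE]] := deck (1, 0, 0).
have [s [s' sE]] := deck (0, 1, 0).
have [m1 [m2 mE]] := deck (0, 0, 1).
pose o : E := (0, 0, 0).
have r'0 : r' = 0.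
  have : F (act 1 (0, 0, 1) (act 1 (1, 0, 0) o)) =
         F (act 1 (1, 0, 0) (act 1 (0, 0, 1) o)) by rewrite !act_mul.
  rewrite mE !rE mE !act_mul => /act_inj; rewrite /gmul /= => -[]; lia.
have s'r : s' = r.
  have : F (act 1 (0, 0, 1) (act 1 (0, 1, 0) o)) =
         F (act 1 (1, 0, 0) (act 1 (0, 1, 0) (act 1 (0, 0, 1) o))).
    by rewrite !act_mul.
  rewrite mE rE !sE mE !act_mul => /act_inj; rewrite /gmul /= => -[]; lia.
exists F, r, s, m1, m2; split => //; split => //.
by apply: level_lift_fibre => e; rewrite ?rE ?sE ?r'0 ?s'r.
Qed.

(** * Angles of maps into the punctured plane *)

(** The angle of (a, b) in turns, measured along the square |a| + |b| = 1; it
    jumps from 1/2 to -1/2 on the negative half-line. *)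
Definition half_turn (a b : R) : R := (1 - a / (`|a| + `|b|)) / 4.
Definition turn (a b : R) : R :=
  if b <= 0 then - half_turn a b else half_turn a b.

Lemma norm1_neq0 (a b : R) : (a, b) <> (0, 0) -> `|a| + `|b| != 0.
Proof.
move=> ab; apply/eqP => h; apply: ab.
have a0 := normr_ge0 a; have b0 := normr_ge0 b.
by congr (_, _); apply/eqP; rewrite -normr_eq0; apply/eqP; lra.
Qed.

Lemma half_turn_axis (a : R) : a != 0 ->
  half_turn a 0 = 0 \/ half_turn a 0 = 2^-1.
Proof.
move=> a0; rewrite /half_turn normr0 addr0; have [h|h] := leP 0 a.
  by left; rewrite ger0_norm// divff// subrr mul0r.
by right; rewrite ltr0_norm// invrN mulrN divff//; lra.
Qed.

Lemma half_turn_opp (a b : R) : (a, b) <> (0, 0) ->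
  half_turn (- a) (- b) = 2^-1 - half_turn a b.
Proof. by rewrite /half_turn !normrN mulNr; lra. Qed.

Lemma turn_opp (a b : R) : (a, b) <> (0, 0) ->
  exists n : int, turn (- a) (- b) = turn a b + 2^-1 + n%:~R.
Proof.
move=> ab; rewrite /turn half_turn_opp// oppr_le0.
have [b0|b0|b0] := ltgtP b 0.
- by exists 0; rewrite mulr0z; lra.
- by exists (-1); rewrite mulrN1z; lra.
- have a0 : a != 0 by apply/eqP => a0; apply: ab; rewrite a0 b0.
  rewrite b0; have [->|->] := half_turn_axis a0.
    by exists (-1); rewrite mulrN1z; lra.
  by exists 0; rewrite mulr0z; lra.
Qed.

Section Angle.
Context (h1 h2 : E -> R).
Hypotheses (ch1 : continuous h1) (ch2 : continuous h2)
  (h0 : forall e, (h1 e, h2 e) <> (0, 0)).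

Lemma half_turn_continuous : continuous (fun e => half_turn (h1 e) (h2 e)).
Proof.
move=> e; apply: cvgM; last exact: cvg_cst.
apply: cvgB; first exact: cvg_cst.
apply: cvgM; first exact: ch1.
apply: cvgV; first exact: norm1_neq0.
by apply: cvgD; apply: cvg_norm; [exact: ch1|exact: ch2].
Qed.

Definition is_angle (theta : E -> R) : Prop := continuous theta /\
  forall e, exists n : int, theta e = turn (h1 e) (h2 e) + n%:~R.

(** The jump of the angle by one turn disappears on the loop alpha, so the
    angle is a continuous map into that loop; its lift is the angle function. *)
Lemma angle_exists : exists theta, is_angle theta.
Proof.
have cht := half_turn_continuous.
pose g e := uc 1 (turn (h1 e) (h2 e), 0, 0).
have cg : continuous g.
  move=> e.
  have -> : g = fun e => if h2 e <= 0
      then uc 1 (- half_turn (h1 e) (h2 e), 0, 0)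
      else uc 1 (half_turn (h1 e) (h2 e), 0, 0).
    by apply/funext => e'; rewrite /g /turn; case: ifP.
  refine (@paste_at R _ _ h2 0 (fun e => uc 1 (- half_turn (h1 e) (h2 e), 0, 0))
    (fun e => uc 1 (half_turn (h1 e) (h2 e), 0, 0)) e (ch2 (x := e)) _ _ _).
  - by apply: (continuous_cmp (@uc_continuous R 1)); ctn.
  - by apply: (continuous_cmp (@uc_continuous R 1)); ctn.
  - move=> e0; have a0 : h1 e != 0.
      by apply/eqP => a0; apply: (h0 (e := e)); rewrite a0 e0.
    rewrite e0; have [->|->] := half_turn_axis a0; first by rewrite oppr0.
    rewrite -(uc_act 1 (1, 0, 0)) act_fibre; congr (uc _ (_, _, _)) => /=; lra.
have [F [cF FE]] := uc_lift cg.
exists (fun e => (F e).1.1); split; first by ctn.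
move=> e; have /uc_fibre[k kE] := esym (FE e); exists k.1.1.
by rewrite -kE /act /= mulr0 addr0.
Qed.

Lemma angle_odd theta (T : E -> E) : is_angle theta -> continuous T ->
  (forall e, h1 (T e) = - h1 e) -> (forall e, h2 (T e) = - h2 e) ->
  exists n : int, forall e, theta (T e) = theta e + 2^-1 + n%:~R.
Proof.
move=> [ct tE] cT T1 T2.
have [|e|n nE] := @int_valued_cst (fun e => theta (T e) - theta e - 2^-1).
- by ctn.
- have [n ->] := tE (T e); have [m ->] := tE e; rewrite T1 T2.
  have [l ->] := turn_opp (h0 (e := e)); exists (l + n - m).
  by rewrite !intrD intrN; lra.
- by exists n => e; rewrite -(nE e); lra.
Qed.

(** Turning twice by half a turn plus integers is an odd number of turns. *)
Lemma no_odd_involution (T : E -> E) : continuous T ->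
  (forall e, T (T e) = e) ->
  (forall e, h1 (T e) = - h1 e) -> (forall e, h2 (T e) = - h2 e) -> False.
Proof.
move=> cT TT T1 T2; have [theta at_] := angle_exists.
have [n nE] := angle_odd at_ cT T1 T2.
have := nE (T (0, 0, 0)); rewrite TT nE.
move=> h; have : (1 + n + n)%:~R = 0 :> R by rewrite !intrD; lra.
by move=> /eqP; rewrite intr_eq0 => /eqP; lia.
Qed.

End Angle.

(** The height is preserved, so the first two coordinates of T e - e would
    be an odd nonvanishing planar map. *)
Lemma no_free_level_involution (T : E -> E) : continuous T ->
  (forall e, T (T e) = e) -> (forall e, (T e).2 = e.2) ->
  (forall e, T e <> e) -> False.
Proof.
move=> cT TT lT T0.
apply: (@no_odd_involution (fun e => (T e).1.1 - e.1.1)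
  (fun e => (T e).1.2 - e.1.2) _ _ _ T) => //.
- by ctn.
- by ctn.
- move=> e [/eqP + /eqP]; rewrite !subr_eq0 => /eqP e1 /eqP e2; apply: (T0 e).
  rewrite [LHS]surjective_pairing [X in (X, _)]surjective_pairing e1 e2 lT.
  by case: e {e1 e2} => -[].
- by move=> e; rewrite TT opprB.
- by move=> e; rewrite TT opprB.
Qed.

(** * Free involutions over the circle *)

(** T is a square root of the translation alpha, like the half translation along
    x to which tau turns out to be conjugate. *)
Record half_period_lift (tau : MA -> MA) (T : E -> E) : Prop := HalfPeriodLift {
  hp_continuous : continuous T;
  hp_lift : forall e, uc 1 (T e) = tau (uc 1 e);
  hp_level : forall e, (T e).2 = e.2;
  hp_square : forall e, T (T e) = act 1 (1, 0, 0) e;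
  hp_deck : forall g e, T (act 1 g e) = act 1 g (T e) }.

(** Writing F^2 = (k1, k2, 0) for a lift F, comparing F^2 with beta and c gives
    r = 1 or -1, s = 0 and k2 even. Translating F by (i, j) changes (k1, k2) by
    (1 + r) (i, j), so if r = -1, where k1 = k2 = 0, or if k1 is even, then some
    lift is an involution, which is impossible. Otherwise some translate of F
    squares to (1, 0, 0), and it commutes with c because m2 = 0 and
    k2 = - 2 m1. *)
Lemma free_involution_lift (tau : MA -> MA) : free_involution_over tau ->
  exists T, half_period_lift tau T.
Proof.
move=> [ctau tautau tau0 ptau].
have [F [r [s [m1 [m2 [[cF lF Ff Fb] FE]]]]]] := over_lift ctau ptau.
have [||e|[[k1 k2] k3] FF] := @uc_lifts R 1 idfun (F \o F).
- exact: continuous_idf.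
- exact: (continuous_cmp cF cF).
- by rewrite /= !FE tautau.
rewrite /= in FF; pose o : E := (0, 0, 0).
have k30 : k3 = 0.
  have : (F (F o)).2 = o.2 + k3%:~R := congr1 snd (FF o).
  by rewrite !lF /= add0r => /esym/eqP; rewrite intr_eq0 => /eqP.
rewrite {}k30 in FF.
have [rs rr] : r * s + s * r = 0 /\ r * r = 1.
  have := FF (act 1 (0, 1, 0) o); rewrite !Ff FF !act_mul => /act_inj.
  by rewrite /gmul /= => -[]; lia.
have [rk1 rk2] : r * k1 + s * k2 = k1 /\ r * k2 = k2.
  have : F (act 1 (k1, k2, 0) o) = act 1 (k1, k2, 0) (F o) by rewrite -!FF.
  by rewrite Ff => /act_inj[].
have [mk1 mk2] : r * m1 + s * m2 + m1 + k2 = 0 /\ r * m2 + m2 = 0.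
  have := FF (act 1 (0, 0, 1) o); rewrite Fb.
  rewrite (_ : act 1 (m1, m2, 1) (F o) =
    act 1 (m1, m2, 0) (act 1 (0, 0, 1) (F o))); last first.
    by rewrite act_mul /gmul /=; congr act; congr (_, _, _); ring.
  rewrite Ff Fb FF !act_mul => /act_inj; rewrite /gmul /= => -[]; lia.
have s0 : s = 0 by nia.
have Ffree e a b : act 1 (a, b, 0) (F e) <> e.
  by move=> /(congr1 (uc 1)); rewrite uc_act FE; exact: tau0.
(* if (k1, k2) is even, then a translate of F is an involution *)
have odd_k j1 j2 : k1 = 2 * j1 -> k2 = 2 * j2 -> False.
  move=> e1 e2; apply: (@no_free_level_involution (act 1 (- j1, - j2, 0) \o F)).
  - exact: (continuous_cmp (@act_continuous R 1 _) cF).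
  - move=> e; rewrite /= Ff FF !act_mul -[RHS](act1 1); congr act.
    by rewrite /gmul /=; congr (_, _, _); nia.
  - by move=> e; rewrite /= lF addr0.
  - by move=> e; exact: Ffree.
have r1 : r = 1.
  have : r = 1 \/ r = -1 by nia.
  case=> // r1; exfalso; apply: (odd_k 0 0); lia.
have [j k1E] : exists j, k1 = 2 * j + 1.
  have [/dvdzP[j jE]|] := boolP (2 %| k1)%Z.
    by exfalso; apply: (odd_k j (- m1)); nia.
  move=> nd; exists (k1 %/ 2)%Z; lia.
pose T := act 1 (- j, m1, 0) \o F.
have T1 e : T (act 1 (1, 0, 0) e) = act 1 (1, 0, 0) (T e).
  rewrite /T /= Ff !act_mul r1 s0; congr act.
  by rewrite /gmul /=; congr (_, _, _); ring.
have T2 e : T (act 1 (0, 1, 0) e) = act 1 (0, 1, 0) (T e).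
  rewrite /T /= Ff !act_mul r1 s0; congr act.
  by rewrite /gmul /=; congr (_, _, _); ring.
have T3 e : T (act 1 (0, 0, 1) e) = act 1 (0, 0, 1) (T e).
  rewrite /T /= Fb !act_mul; congr act.
  by rewrite /gmul /=; congr (_, _, _); nia.
exists T; split.
- exact: (continuous_cmp (@act_continuous R 1 _) cF).
- by move=> e; rewrite uc_act FE.
- by move=> e; rewrite /= lF addr0.
- move=> e; rewrite /T /= Ff FF !act_mul; congr act.
  by rewrite /gmul /=; congr (_, _, _); nia.
- move=> [[a b] n].
  pose S g := forall e, T (act 1 g e) = act 1 g (T e).
  have SM g h : S g -> S h -> S (gmul 1 g h).
    by move=> Sg Sh e; rewrite -!act_mul Sg Sh.
  have SV g : S g -> S (ginv 1 g).
    move=> Sg e; have := Sg (act 1 (ginv 1 g) e); rewrite actVK => ->.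
    by rewrite actK.
  have := gen_mem SM SV T1 (T2 : S (0, 1, 0)) (T3 : S (0, 0, 1)) a b n.
  by rewrite mul1r !mul0r !addr0.
Qed.

End Lifts.

Section OrbitProjection.
Context {R : realType} {A : 'M[int]_2}
  (tau : torus_bundle R A -> torus_bundle R A).
Hypothesis ftau : free_involution_over tau.
Notation M := (torus_bundle R A).

Definition orbit_proj (z : M) : orbit_space tau := \pi_(orbit_space tau) z.

Lemma orbit_proj_tau z : orbit_proj (tau z) = orbit_proj z.
Proof. exact: (esym (@glued_eq _ (fun z w => w = tau z) _ _ _)). Qed.

Lemma orbit_proj_eq (z w : M) : orbit_proj z = orbit_proj w ->
  w = z \/ w = tau z.
Proof.
have tauK := fio_involutive ftau.
apply: (glued_class (s := fun z w => w = z \/ w = tau z)).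
- by move=> x y; right.
- by move=> x; left.
- by move=> x y [->|->]; [left|right; rewrite tauK].
- move=> x y u [->|->] [->|->]; rewrite ?tauK; by [left|right].
Qed.

Lemma orbit_proj_continuous : continuous orbit_proj.
Proof. exact: (@glued_pi_continuous _ (fun z w => w = tau z)). Qed.

Lemma orbit_proj_surj q : exists z, orbit_proj z = q.
Proof. by exists (repr q); rewrite /orbit_proj reprK. Qed.

Lemma orbit_proj_open : open_map orbit_proj.
Proof.
split=> U oU; have tauK := fio_involutive ftau.
suff : open (orbit_proj @^-1` (orbit_proj @` U)) by [].
have -> : orbit_proj @^-1` (orbit_proj @` U) = U `|` tau @^-1` U.
  apply/seteqP; split => z.
    move=> [w Uw /orbit_proj_eq[zw|zw]]; first by left; rewrite zw.
    by right; rewrite /preimage /= zw tauK.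
  move=> [Uz|Uz]; first by exists z.
  by exists (tau z) => //; exact: orbit_proj_tau.
apply: openU => //; move: U oU; apply/continuousP.
exact: fio_continuous ftau.
Qed.

End OrbitProjection.

(** * Existence of the involution *)

Section Involutions.
Context {R : realType}.
Notation E := (R * R * R)%type.
Notation A := (mx2 1 1 0 1).
Notation B := (mx2 1 2 0 1).
Notation MA := (torus_bundle R A).
Notation MB := (torus_bundle R B).

Definition half_shift (e : E) : E := (e.1.1 + 2^-1, e.1.2, e.2).

Lemma half_shift_continuous : continuous half_shift.
Proof. by rewrite /half_shift; ctn. Qed.

Lemma half_shift_not_deck g (e : E) : act 1 g e <> half_shift e.
Proof.
case: g => -[a b] n [/[swap] _ /[swap] et ex].
have n0 : n = 0 by apply: (@int_small R); lra.
move: ex; rewrite n0 mulr0 mul0r addr0 => /addrI ea.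
have : (a + a)%:~R = (1%:~R : R) by rewrite intrD; lra.
by move=> /intr_inj; lia.
Qed.

Lemma half_shift_involution : exists tau : MA -> MA,
  free_involution_over tau /\ half_period_lift tau half_shift.
Proof.
have deck g e : half_shift (act 1 g e) = act 1 g (half_shift e).
  by rewrite /half_shift /act /=; congr (_, _, _); ring.
have square (e : E) : half_shift (half_shift e) = act 1 (1, 0, 0) e.
  by rewrite act_fibre /half_shift /=; congr (_, _, _); rewrite ?addr0//; lra.
have [|e e' /uc_fibre[g <-]|tau ctau tauE] := @descend _ _ (uc 1) (@uc_open R 1)
    (@uc_surj R 1) _ (uc 1 \o half_shift).
- exact: (continuous_cmp (@uc_continuous R 1) half_shift_continuous).
- by rewrite /= deck uc_act.
exists tau; split; last first.
  by apply: (HalfPeriodLift half_shift_continuous).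
split => //.
- by move=> z; have [e <-] := uc_surj z; rewrite !tauE /= square uc_act.
- move=> z; have [e <-] := uc_surj z; rewrite tauE /= => /esym/uc_fibre[g].
  exact: half_shift_not_deck.
- by move=> z; have [e <-] := uc_surj z; rewrite tauE /= !bproj_uc.
Qed.

Section OrbitSpace.
Context (tau : MA -> MA) (T : E -> E).
Hypotheses (ftau : free_involution_over tau) (hT : half_period_lift tau T).

Definition orbit_cover (e : E) : orbit_space tau := orbit_proj tau (uc 1 e).

Lemma orbit_cover_fibre (e e' : E) : orbit_cover e = orbit_cover e' <->
  exists g, e' = act 1 g e \/ e' = T (act 1 g e).
Proof.
split.
  move=> /(orbit_proj_eq ftau)[/esym/uc_fibre[g <-]|]; first by exists g; left.
  rewrite -(hp_lift hT) => /esym/uc_fibre[g <-].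
  by exists g; right; rewrite (hp_deck hT).
move=> [g [->|->]]; rewrite /orbit_cover ?(hp_lift hT) ?orbit_proj_tau uc_act//.
Qed.

Lemma orbit_cover_continuous : continuous orbit_cover.
Proof.
exact: (continuous_cmp (@orbit_proj_continuous _ _ tau) (@uc_continuous R 1)).
Qed.

Lemma orbit_cover_surj q : exists e, orbit_cover e = q.
Proof.
have [z <-] := orbit_proj_surj q; have [e <-] := uc_surj z.
by exists e.
Qed.

Lemma orbit_cover_open : open_map orbit_cover.
Proof. exact: (open_map_comp (@uc_open R 1) (orbit_proj_open ftau)). Qed.

End OrbitSpace.

Definition double (e : E) : E := (2 * e.1.1, e.1.2, e.2).

(** Doubling x turns the half period into a period and the shear by 1 into
    the shear by 2. *)
Lemma half_shift_orbit_space (tau : MA -> MA) : free_involution_over tau ->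
  half_period_lift tau half_shift -> homeomorphic (orbit_space tau) MB.
Proof.
move=> ftau hT.
have doubleA i b n e :
    double (act 1 (i, b, n) e) = act 2 (2 * i, b, n) (double e).
  by rewrite /double /act /=; congr (_, _, _); rewrite ?intrM; ring.
have doubleT e : double (half_shift e) = act 2 (1, 0, 0) (double e).
  by rewrite act_fibre /double /=; congr (_, _, _); rewrite ?addr0//; lra.
have hd : homeomorphism double.
  split; first by rewrite /double; ctn.
  exists (fun e : E => (2^-1 * e.1.1, e.1.2, e.2)); split; first by ctn.
    by case=> -[x y] t; rewrite /double /=; congr (_, _, _); lra.
  by case=> -[x y] t; rewrite /double /=; congr (_, _, _); lra.
have dinj : injective double by move: hd => [_ [? [_ /can_inj]]].
have [|||||||h hh _] := @same_fibres_homeomorphism _ _ _ (@orbit_cover tau)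
  (uc 2 \o double); last by exists h.
- exact: orbit_cover_continuous.
- exact: (orbit_cover_open ftau).
- exact: orbit_cover_surj.
- exact: (continuous_cmp (@uc_continuous R 2) hd.1).
- by apply: open_map_comp (@uc_open R 2); exact: homeomorphism_open.
- move=> z; have [e <-] := uc_surj z; have [_ [d' [_ _ d'K]]] := hd.
  by exists (d' e); rewrite /= d'K.
move=> e e'; rewrite (orbit_cover_fibre ftau hT); split.
  move=> [[[i b] n] [->|->]] /=; first by rewrite doubleA uc_act.
  by rewrite doubleT doubleA !uc_act.
move=> /uc_fibre[[[a b] n] h].
have [/dvdzP[i iE]|nd] := boolP (2 %| a)%Z.
  exists (i, b, n); left; apply: dinj.
  by rewrite doubleA -h iE mulrC.
exists ((a %/ 2)%Z, b, n); right; apply: dinj.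
rewrite doubleT doubleA -h act_mul; congr act.
by rewrite /gmul /=; congr (_, _, _); lia.
Qed.

(** * Uniqueness of the involution up to conjugation *)

Lemma nonint_near (W : topologicalType) (u : W -> R) (w : W) :
  {for w, continuous u} -> (forall n : int, u w <> n%:~R) ->
  \forall v \near w, forall n : int, u v <> n%:~R.
Proof.
move=> cu nw; have /andP[lo hi] := floor_itv (u w).
rewrite le_eqVlt in lo; case/orP : lo => [/eqP/esym/nw//|lo].
near=> v => n uv.
have : (Num.floor (u w))%:~R < u v by near: v; exact: (cu _ (lt_nbhsr lo)).
have : u v < (Num.floor (u w) + 1)%:~R by near: v; exact: (cu _ (lt_nbhsl hi)).
by rewrite uv !ltr_int; lia.
Unshelve. all: by end_near. Qed.

Section Uniqueness.
Context (tau : MA -> MA) (T : E -> E) (phi : orbit_space tau -> MB).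
Hypotheses (ftau : free_involution_over tau) (hT : half_period_lift tau T)
  (hphi : homeomorphism phi).

(** Q is the covering R^3 -> MA -> MA_tau = MB, and G is its deck group. *)
Let Q (e : E) : MB := phi (orbit_cover tau e).

Let G : set (E -> E) := [set gamma | exists g,
  gamma = act 1 g \/ gamma = T \o act 1 g].

Lemma T_not_deck g e : T e <> act 1 g e.
Proof.
move=> /(congr1 (uc 1)); rewrite uc_act (hp_lift hT).
exact: fio_free ftau (uc 1 e).
Qed.

Lemma T_inj : injective T.
Proof.
move=> e e' /(congr1 T); rewrite !(hp_square hT).
by move=> /(congr1 (act 1 (ginv 1 (1, 0, 0)))); rewrite !actK.
Qed.

(** As T preserves the height, T u and u' can only differ by an integer vector
    in x and y if they are near T e and e. This difference is not an integer
    vector at e, hence not nearby. *)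
Lemma T_separated (e : E) : exists N : set E, nbhs e N /\
  forall u u' g, N u -> N u' -> u' <> T (act 1 g u).
Proof.
have cT := hp_continuous hT.
pose dx (z : E * E) := z.2.1.1 - (T z.1).1.1.
pose dy (z : E * E) := z.2.1.2 - (T z.1).1.2.
pose dt (z : E * E) := z.2.2 - z.1.2.
have cdx : continuous dx by rewrite /dx; ctn.
have cdy : continuous dy by rewrite /dy; ctn.
have cdt : continuous dt by rewrite /dt; ctn.
have bad : \forall z \near (e, e), forall a b : int,
    ~ (dx z = a%:~R /\ dy z = b%:~R).
  have [[a ea]|na] := pselect (exists a : int, dx (e, e) = a%:~R).
    have [[b eb]|nb] := pselect (exists b : int, dy (e, e) = b%:~R).
      exfalso; apply: (@T_not_deck (- a, - b, 0) e).
      rewrite act_fibre !intrN -ea -eb /dx /dy /= -(hp_level hT e).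
      rewrite !opprB !subrKC.
      by case: (T e) => -[].
    have nb' (n : int) : dy (e, e) <> n%:~R by move=> en; apply: nb; exists n.
    by apply: filterS (nonint_near (cdy (e, e)) nb') => z zn a' b [_ /zn].
  have na' (n : int) : dx (e, e) <> n%:~R by move=> en; apply: na; exists n.
  by apply: filterS (nonint_near (cdx (e, e)) na') => z zn a' b [/zn].
have small : \forall z \near (e, e), -1 < dt z < 1.
  have d0 : dt (e, e) = 0 by rewrite /dt subrr.
  have lo : -1 < dt (e, e) by rewrite d0; lra.
  have hi : dt (e, e) < 1 by rewrite d0; lra.
  near=> z; apply/andP; split; near: z; first exact: (cdt _ _ (lt_nbhsr lo)).
  exact: (cdt _ _ (lt_nbhsl hi)).
have [[N N'] /= [Ne N'e] NN'] := filterI bad small.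
exists (N `&` N'); split; first exact: filterI.
move=> u u' [[a b] n] [Nu N'u] [Nu' N'u'] uu'.
have [/= nbad] := NN' (u, u') (conj Nu N'u'); rewrite /dt /=.
have uu2 : u' = act 1 (a, b, n) (T u) by rewrite -(hp_deck hT).
have ut : u'.2 = u.2 + n%:~R by rewrite uu2 /= (hp_level hT).
rewrite ut addrAC subrr add0r => /int_small n0.
apply: (nbad a b); rewrite /dx /dy uu2 n0 act_fibre /=.
by split; rewrite addrAC subrr add0r.
Unshelve. all: by end_near. Qed.

Lemma quotient_covering : deck_covering Q G.
Proof.
have [cphi [phi' [cphi' phiK phi'K]]] := hphi.
have QE e e' : Q e = Q e' <-> exists g, e' = act 1 g e \/ e' = T (act 1 g e).
  rewrite -(orbit_cover_fibre ftau hT); split => [/(can_inj phiK)//|].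
  by rewrite /Q => ->.
split.
- exact: (continuous_cmp cphi (@orbit_cover_continuous tau)).
- apply: (open_map_comp (orbit_cover_open ftau)).
  exact: homeomorphism_open.
- move=> z; have [e eE] := orbit_cover_surj (phi' z).
  by exists e; rewrite /Q eE.
- move=> _ [g [->|->]]; first exact: act_continuous.
  exact: (continuous_cmp (hp_continuous hT) (@act_continuous R 1 g)).
- by move=> gamma e [g gE]; apply/esym/QE; exists g;
    case: gE => ->; [left|right].
- move=> e e' /QE[g [->|->]].
    by exists (act 1 g) => //; exists g; left.
  by exists (T \o act 1 g) => //; exists g; right.
- move=> _ _ e [g [->|->]] [h [->|->]] /=.
  + by move=> /act_inj ->.
  + rewrite (hp_deck hT) => /esym/(congr1 (act 1 (ginv 1 h))).
    by rewrite actK act_mul => /T_not_deck.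
  + rewrite (hp_deck hT) => /(congr1 (act 1 (ginv 1 g))).
    by rewrite actK act_mul => /T_not_deck.
  + by move=> /T_inj/act_inj ->.
- move=> e; have [U [[oU Ue] Uinj]] := uc_locally_injective 1 e.
  have [N [Ne Nsep]] := T_separated e.
  exists (U `&` N°); split.
    split; first by apply: openI => //; exact: open_interior.
    by split => //; exact: nbhs_singleton (nbhs_interior Ne).
  move=> u u' /set_mem[Uu /interior_subset Nu].
  move=> /set_mem[Uu' /interior_subset Nu'].
  move=> /QE[g [uu'|]]; last by move=> /Nsep; case.
  by apply: Uinj; rewrite ?uu' ?uc_act//; apply/mem_set; rewrite -?uu'.
Qed.

(** Lift each of the two coverings of MB by R^3 through the other: both
    composites lift a covering through itself, so they are deck
    transformations. *)
Lemma covering_homeomorphism : exists F F' : E -> E, [/\ continuous F,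
  continuous F', cancel F F', cancel F' F & forall e, uc 2 (F e) = Q e].
Proof.
have dcQ := quotient_covering.
have [F [cF FE]] := uc_lift (dc_continuous dcQ).
have [e0 e0E] := dc_surj dcQ (uc 2 (0, 0, 0)).
have [K [cK _ KE]] := space_lift dcQ (@uc_continuous R 2) e0E.
have [||e|g gE] := @uc_lifts R 2 (F \o K) idfun.
- exact: (continuous_cmp cF cK).
- exact: continuous_idf.
- by rewrite /= FE KE.
have [||e|gamma Ggamma gammaE] := @space_lifts_deck R _ Q G dcQ (K \o F) idfun.
- exact: (continuous_cmp cK cF).
- exact: continuous_idf.
- by rewrite /= KE FE.
have FK e : F (K (act 2 g e)) = e.
  have /(congr1 (act 2 (ginv 2 g))) := gE (act 2 g e).
  by rewrite /= !actK.
have Finj : injective F.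
  by move=> e e' ee'; rewrite -[e]/(idfun e) -[e']/(idfun e') !gammaE /= ee'.
exists F, (K \o act 2 g); split => //.
- exact: (continuous_cmp cK (@act_continuous R 2 g)).
- by move=> e; apply: Finj; rewrite /= FK.
Qed.

Section Conjugation.
Context (F F' : E -> E).
Hypotheses (cF : continuous F) (cF' : continuous F') (FK : cancel F F')
  (F'K : cancel F' F) (FE : forall e, uc 2 (F e) = Q e).

Lemma conj_deck gamma : G gamma ->
  exists g, forall e, F (gamma e) = act 2 g (F e).
Proof.
move=> Ggamma; have cgamma := dc_deck_continuous quotient_covering Ggamma.
have [||e|g gE] := @uc_lifts R 2 idfun (F \o gamma \o F').
- exact: continuous_idf.
- exact: (continuous_cmp (continuous_cmp cF cgamma) cF').
- by rewrite /= FE (dc_deck quotient_covering _ Ggamma) -FE F'K.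
by exists g => e; rewrite -(gE (F e)) /= FK.
Qed.

Lemma deck_conj g :
  exists2 gamma, G gamma & forall e, F (gamma e) = act 2 g (F e).
Proof.
have [||e|gamma Gg gE] := @space_lifts_deck R _ Q G quotient_covering idfun
    (F' \o act 2 g \o F).
- exact: continuous_idf.
- exact: (continuous_cmp (continuous_cmp cF' (@act_continuous R 2 g)) cF).
- by rewrite /= -!FE F'K uc_act.
by exists gamma => // e; rewrite -[gamma e]gE /= F'K.
Qed.

(** The subgroup of pi_1(MB) that corresponds to pi_1(MA) under F. *)
Definition sub_deck : set (int * int * int) :=
  [set g | exists h, forall e, F (act 1 h e) = act 2 g (F e)].

Lemma sub_deckM g h : sub_deck g -> sub_deck h -> sub_deck (gmul 2 g h).
Proof.
move=> [g' gE] [h' hE]; exists (gmul 1 g' h') => e.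
by rewrite -!act_mul gE hE.
Qed.

Lemma sub_deckV g : sub_deck g -> sub_deck (ginv 2 g).
Proof.
move=> [g' gE]; exists (ginv 1 g') => e.
by rewrite -[in RHS](actVK 1 g' e) gE actK.
Qed.

Lemma not_sub_deck g : ~ sub_deck g ->
  exists h, forall e, F (T (act 1 h e)) = act 2 g (F e).
Proof.
move=> ng; have [gamma [h [->|->]] hE] := deck_conj g; last by exists h.
by case: ng; exists h.
Qed.

(** A deck transformation that does not come from MA is T times one that does,
    and T^2 = alpha. *)
Lemma sub_deck_index2 g h :
  ~ sub_deck g -> ~ sub_deck h -> sub_deck (gmul 2 g h).
Proof.
move=> /not_sub_deck[g' gE] /not_sub_deck[h' hE].
exists (gmul 1 (1, 0, 0) (gmul 1 g' h')) => e.
by rewrite -!act_mul -hE -gE -(hp_square hT) (hp_deck hT g' (act 1 h' e)).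
Qed.

(** T is central in the deck group of Q, and the centre of the deck group of
    MB consists of the translations along x. *)
Lemma conj_T : exists j, forall e, F (T e) = act 2 (j, 0, 0) (F e).
Proof.
have GT : G T.
  by exists (0, 0, 0); right; apply/funext => e /=; rewrite act1.
have [[[j b] n] jE] := conj_deck GT.
have comm g : gmul 2 (j, b, n) g = gmul 2 g (j, b, n).
  have [gamma Ggamma gE] := deck_conj g.
  apply: (@act_inj R 2 _ _ (F (0, 0, 0))); rewrite -!act_mul -gE -!jE -gE.
  congr F; case: Ggamma => h [->|->] /=; first exact: (hp_deck hT).
  by rewrite (hp_deck hT).
have := comm (0, 1, 0); have := comm (0, 0, 1); rewrite /gmul /=.
move=> /(congr1 (fun z => z.1.1)) /= e1 /(congr1 (fun z => z.1.1)) /= e2.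
by exists j => e; rewrite jE; congr act; congr (_, _, _); lia.
Qed.

(** Otherwise F T F^-1, a power of the translation by 1 along x, would come from
    the deck group of MA. *)
Lemma sub_deck1 : ~ sub_deck (1, 0, 0).
Proof.
move=> S1; have [j jE] := conj_T.
have [||h hE] := @gpow_mem 2 sub_deck sub_deckM sub_deckV (1, 0, 0)
  (fun n => (n, 0, 0)) S1 _ _ j.
- by [].
- by move=> n; rewrite /gmul /= !mulr0 !addr0.
have := hE (0, 0, 0); rewrite -jE => /(can_inj FK)/esym.
exact: T_not_deck.
Qed.

(** Hence sub_deck is the kernel of a homomorphism to Z/2 mapping a to 1, and
    e2, e3 are chosen such that it vanishes at a^e2 b and a^e3 c. *)
Lemma sub_deck_kernel : exists e2 e3 : int, forall a b n,
  sub_deck (a, b, n) <-> (2 %| a - e2 * b - e3 * n)%Z.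
Proof.
have S2 : sub_deck (2, 0, 0).
  have := sub_deck_index2 sub_deck1 sub_deck1.
  by rewrite /gmul /= !mulr0 !addr0.
have [e2 Se2] : exists e2, sub_deck (e2, 1, 0).
  have [S|S] := pselect (sub_deck (0, 1, 0)); first by exists 0.
  exists 1; have := sub_deck_index2 sub_deck1 S.
  by rewrite /gmul /= !mulr0 mul0r !addr0 add0r.
have [e3 Se3] : exists e3, sub_deck (e3, 0, 1).
  have [S|S] := pselect (sub_deck (0, 0, 1)); first by exists 0.
  exists 1; have := sub_deck_index2 sub_deck1 S.
  by rewrite /gmul /= !mulr0 !addr0 add0r.
have gen := gen_mem sub_deckM sub_deckV S2 Se2 Se3.
exists e2, e3 => a b n; split; last first.
  move=> /dvdzP[i iE]; have := gen i b n.
  by rewrite (_ : 2 * i + e2 * b + e3 * n = a)//; lia.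
move=> Sabn; apply: contrapT => nd.
have ex : exists i, a = 1 + (2 * i + e2 * b + e3 * n).
  exists ((a - e2 * b - e3 * n) %/ 2)%Z.
  move: nd; move: (e2 * b) (e3 * n) => p q; lia.
have [i aE] := ex.
apply: sub_deck1; have := sub_deckM Sabn (sub_deckV (gen i b n)).
rewrite /gmul /ginv /= (_ : (_, _, _) = (1, 0, 0))// aE.
by congr (_, _, _); ring.
Qed.

(** Otherwise (j, 0, 0) would lie in the kernel sub_deck. *)
Lemma conj_T_odd j : (forall e, F (T e) = act 2 (j, 0, 0) (F e)) ->
  exists i, j = 2 * i + 1.
Proof.
move=> jE; have [e2 [e3 SE]] := sub_deck_kernel.
have nS : ~ sub_deck (j, 0, 0).
  move=> [h hE]; have := hE (0, 0, 0); rewrite -jE => /(can_inj FK)/esym.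
  exact: T_not_deck.
exists (j %/ 2)%Z.
have : ~ (2 %| j)%Z by move=> d; apply: nS; apply/SE; rewrite !mulr0 !subr0.
by lia.
Qed.

(** The conjugating map is L o F, where L straightens the kernel sub_deck to
    the subgroup of all (a, b, n) with a even and then halves x, inverting the
    map double above. *)
Lemma conjugate_half_shift (tau0 : MA -> MA) :
  half_period_lift tau0 half_shift ->
  exists2 h : MA -> MA, homeomorphism h & forall z, h (tau z) = tau0 (h z).
Proof.
move=> hT0; have [e2 [e3 SE]] := sub_deck_kernel.
pose L (e : E) : E :=
  (2^-1 * (e.1.1 - e2%:~R * e.1.2 - e3%:~R * e.2), e.1.2, e.2).
pose L' (e : E) : E := (2 * e.1.1 + e2%:~R * e.1.2 + e3%:~R * e.2, e.1.2, e.2).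
have cL : continuous L by rewrite /L; ctn.
have cL' : continuous L' by rewrite /L'; ctn.
have LK : cancel L L'.
  by case=> -[x y] t; rewrite /L /L' /=; congr (_, _, _); field.
have L'K : cancel L' L.
  by case=> -[x y] t; rewrite /L /L' /=; congr (_, _, _); field.
(* L conjugates the kernel to the deck group of MA *)
have Lact i b n e :
    L (act 2 (2 * i + e2 * b + e3 * n, b, n) e) = act 1 (i, b, n) (L e).
  by rewrite /L /act /=; congr (_, _, _); rewrite ?intrD ?intrM; field.
pose H := L \o F.
have hH : homeomorphism H.
  split; first exact: (continuous_cmp cL cF).
  exists (F' \o L'); split; first exact: (continuous_cmp cF' cL').
    by move=> e; rewrite /H /= LK FK.
  by move=> e; rewrite /H /= F'K L'K.
have HE e e' : uc 1 e = uc 1 e' <-> uc 1 (H e) = uc 1 (H e').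
  split.
    move=> /uc_fibre[g <-].
    have Gg : G (act 1 g) by exists g; left.
    have [[[a b] n] aE] := conj_deck Gg.
    have /SE/dvdzP[i iE] : sub_deck (a, b, n) by exists g.
    rewrite /H /= aE (_ : a = 2 * i + e2 * b + e3 * n) ?Lact ?uc_act//.
    by move: iE; move: (e2 * b) (e3 * n) => p q; lia.
  move=> /uc_fibre[[[i b] n]]; rewrite -Lact => /(can_inj LK).
  have [|g gE] := (SE (2 * i + e2 * b + e3 * n) b n).2.
    by apply/dvdzP; exists i; ring.
  by rewrite -gE => /(can_inj FK) <-; rewrite uc_act.
have [|||||||h hh hE] := @same_fibres_homeomorphism _ _ _ (uc 1) (uc 1 \o H).
- exact: uc_continuous.
- exact: uc_open.
- exact: uc_surj.
- exact: (continuous_cmp (@uc_continuous R 1) hH.1).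
- by apply: open_map_comp (@uc_open R 1); exact: homeomorphism_open.
- move=> z; have [e <-] := uc_surj z; have [_ [d' [_ _ d'K]]] := hH.
  by exists (d' e); rewrite /= d'K.
- exact: HE.
exists h => // z; have [e <-] := uc_surj z.
have [j jE] := conj_T; have [i iE] := conj_T_odd jE.
rewrite -(hp_lift hT) !hE -(hp_lift hT0) /= /H /= jE.
rewrite (_ : L _ = act 1 (i, 0, 0) (half_shift (L (F e)))) ?uc_act//.
rewrite !act_fibre /L /half_shift /= iE intrD intrM.
by congr (_, _, _); rewrite ?addr0//; field.
Qed.

End Conjugation.

Lemma conjugate_to_half_shift (tau0 : MA -> MA) :
  half_period_lift tau0 half_shift ->
  exists2 h : MA -> MA, homeomorphism h & forall z, h (tau z) = tau0 (h z).
Proof.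
move=> hT0; have [F [F' [cF cF' FK F'K FE]]] := covering_homeomorphism.
exact: (conjugate_half_shift cF cF' FK F'K FE hT0).
Qed.

End Uniqueness.

Lemma free_involution_unique (tau tau' : MA -> MA) :
  free_involution_over tau -> homeomorphic (orbit_space tau) MB ->
  free_involution_over tau' -> homeomorphic (orbit_space tau') MB ->
  conjugate_maps tau tau'.
Proof.
move=> ft [phi hphi] ft' [phi' hphi'].
have [T hT] := free_involution_lift ft.
have [T' hT'] := free_involution_lift ft'.
have [tau0 [_ h0]] := half_shift_involution.
have [h hh hE] := conjugate_to_half_shift ft hT hphi h0.
have [h' hh' hE'] := conjugate_to_half_shift ft' hT' hphi' h0.
have [k [hk h'K kK]] := homeomorphism_inv hh'.
exists (k \o h); first exact: homeomorphism_comp.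
by move=> z /=; apply: (can_inj h'K); rewrite kK hE hE' kK.
Qed.

End Involutions.

(** * Loops and exponents *)

Section FundamentalGroup.
Context {R : realType}.
Notation E := (R * R * R)%type.
Notation A := (mx2 1 1 0 1).
Notation MA := (torus_bundle R A).
Notation base := (@bbase R A).
Notation origin := ((0, 0, 0) : E).

(** The class of a loop is recorded by the deck transformation that carries
    the initial point of its lift to the final point. *)
Definition ends (a : pi1 R base) (g : int * int * int) : Prop :=
  exists (l : R -> E) (p : loop R base), [/\ continuous l, l 0 = origin,
    l 1 = act 1 g origin, forall t, p t = uc 1 (l (ival t)) & a = cls p].

(** Paths in R^3 with the same end points are homotopic by convexity. *)
Lemma ends_eq a b g : ends a g -> ends b g -> a = b.
Proof.
move=> [l [p [cl l0 l1 pE ->]]] [l' [p' [cl' l'0 l'1 p'E ->]]].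
apply/eqP/pi1_eqP.
pose mix (x y s : R) := x + s * (y - x).
exists (fun z => uc 1 (mix (l (ival z.1)).1.1 (l' (ival z.1)).1.1 (ival z.2),
  mix (l (ival z.1)).1.2 (l' (ival z.1)).1.2 (ival z.2),
  mix (l (ival z.1)).2 (l' (ival z.1)).2 (ival z.2))).
have mix0 x y : mix x y 0 = x by rewrite /mix mul0r addr0.
have mix1 x y : mix x y 1 = y by rewrite /mix mul1r subrKC.
have mixx x s : mix x x s = x by rewrite /mix subrr mulr0 addr0.
split.
- apply: (continuous_cmp (@uc_continuous R 1)); rewrite /mix.
  have ci := @ival_continuous R.
  by ctn.
- by move=> t /=; rewrite ival0 !mix0 pE; congr uc; case: (l _) => -[].
- by move=> t /=; rewrite ival1 !mix1 p'E; congr uc; case: (l' _) => -[].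
- move=> s /=; rewrite ival0 ival1 l0 l'0 l1 l'1 !mixx; split.
    exact: uc_base.
  by rewrite -[RHS](uc_base 1) -[RHS](uc_act 1 g).
Qed.

(** A homotopy of loops lifts to a homotopy of paths whose end points move in
    a fibre, hence do not move. *)
Lemma ends_inj a g h : ends a g -> ends a h -> g = h.
Proof.
move=> [l [p [cl l0 l1 pE ->]]] [l' [p' [cl' l'0 l'1 p'E pp']]].
have /pi1_eqP[H [cH H0 H1 HP]] : \pi_(pi1 R base) p == \pi_(pi1 R base) p'.
  exact/eqP.
have cc := @clamp_continuous R; have ci := @ival_continuous R.
have clamp0 : clamp 0 = zero :> I01 R by [].
have clamp1 : clamp 1 = one :> I01 R by [].
have [||K [cK K0 KE]] := space_lift (uc_covering 1) (e0 := origin)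
    (f := fun e : E => H (clamp e.1.1, clamp e.1.2)).
- by apply: (continuous_cmp cH); ctn.
- by rewrite uc_base /= clamp0 (HP zero).1.
have unique (f f' : R -> E) : continuous f -> continuous f' ->
    (forall x, uc 1 (f x) = uc 1 (f' x)) -> f 0 = f' 0 -> forall x, f x = f' x.
  move=> cf cf' ff' f0.
  exact: (path_lift_unique (uc_covering 1) cf cf' ff' f0).
have left_side s : K (0, s, 0) = origin.
  apply: (unique (fun s => K (0, s, 0)) (fun=> origin) _ _ _ _) => //.
  - by ctn.
  - by ctn.
  - by move=> x; rewrite KE /= clamp0 (HP _).1 uc_base.
have bottom t : K (t, 0, 0) = l (ival (clamp t)).
  apply: (unique (fun t => K (t, 0, 0)) (fun t => l (ival (clamp t)))
    _ _ _ _) => //.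
  - by ctn.
  - by ctn.
  - by move=> x; rewrite KE /= clamp0 H0 pE.
  - by rewrite K0 clamp0 ival0.
have top t : K (t, 1, 0) = l' (ival (clamp t)).
  apply: (unique (fun t => K (t, 1, 0)) (fun t => l' (ival (clamp t)))
    _ _ _ _) => //.
  - by ctn.
  - by ctn.
  - by move=> x; rewrite KE /= clamp1 H1 p'E.
  - by rewrite left_side clamp0 ival0.
have right_side s : K (1, s, 0) = act 1 g origin.
  apply: (unique (fun s => K (1, s, 0)) (fun=> act 1 g origin) _ _ _ _) => //.
  - by ctn.
  - by ctn.
  - by move=> x; rewrite KE /= clamp1 (HP _).2 uc_act uc_base.
  - by rewrite bottom clamp1 ival1.
by apply: (@act_inj R 1 _ _ origin); rewrite -(right_side 1) top clamp1 ival1.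
Qed.

Lemma ends1 : ends 1%g (0, 0, 0).
Proof.
exists (fun=> origin), (loop_cst R base); split => //.
- by ctn.
- by rewrite act1.
- by move=> t; rewrite uc_base.
Qed.

Lemma endsM a b g h : ends a g -> ends b h -> ends (a * b)%g (gmul 1 g h).
Proof.
move=> [l [p [cl l0 l1 pE ->]]] [l' [p' [cl' l'0 l'1 p'E ->]]].
have cact := @act_continuous R 1 g.
pose m (t : R) := if t <= 2^-1 then l (2 * t) else act 1 g (l' (2 * t - 1)).
exists m, (loop_concat p p'); split.
- apply: (@continuous_paste R _ _ (fun t : R => t) (fun t => l (2 * t))
    (fun t => act 1 g (l' (2 * t - 1)))); [by ctn|by ctn|by ctn|].
  by move=> t ->; rewrite divff ?pnatr_eq0// l1 subrr l'0.
- by rewrite /m ifT ?invr_ge0// mulr0.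
- rewrite /m ifF; last by apply/negbTE; rewrite -ltNge; lra.
  by rewrite mulr1 subr2_1 l'1 act_mul.
- move=> t; rewrite loop_concatE /m.
  have t0 := ival_ge0 t; have t1 := ival_le1 t.
  have [h2|h2] := leP (ival t) 2^-1.
    by rewrite pE addr0 clampK//; lra.
  by rewrite p'E uc_act clampK//; lra.
- exact: pi1_mulE.
Qed.

Lemma endsV a g : ends a g -> ends a^-1%g (ginv 1 g).
Proof.
move=> [l [p [cl l0 l1 pE ->]]].
have cact := @act_continuous R 1 (ginv 1 g).
exists (fun t => act 1 (ginv 1 g) (l (-1 * t + 1))), (loop_rev p); split.
- by ctn.
- by rewrite mulr0 add0r l1 actK.
- by rewrite mulr1 addNr l0.
- move=> t; rewrite loop_revE pE uc_act clampK//.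
  by have := ival_ge0 t; have := ival_le1 t; lra.
- exact: pi1_invE.
Qed.

Lemma ends_expgz a (pw : int -> int * int * int) : ends a (pw 1) ->
  pw 0 = (0, 0, 0) -> (forall m n, pw (m + n) = gmul 1 (pw m) (pw n)) ->
  (forall n, ginv 1 (pw n) = pw (- n)) -> forall n, ends (expgz a n) (pw n).
Proof.
move=> a1 pw0 pwD pwN n.
have pos (k : nat) : ends (a ^+ k)%g (pw k%:Z).
  elim: k => [|k IH]; first by rewrite pw0; exact: ends1.
  by rewrite expgS intS pwD; exact: endsM.
case: n => k; first exact: pos.
by rewrite NegzE -pwN; apply: endsV; exact: pos.
Qed.

Lemma ends_alpha : ends (cls (loop_alpha R A)) (1, 0, 0).
Proof.
exists (fun t => (t, 0, 0)), (loop_alpha R A); split => //.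
- by ctn.
- by rewrite act_fibre /= !add0r.
- move=> t; rewrite uc_bpt0 -[LHS]/(bpt _ (tor (1 * ival t) (0 * ival t)) _).
  by rewrite mul1r mul0r.
Qed.

Lemma ends_beta : ends (cls (loop_beta R A)) (0, 1, 0).
Proof.
exists (fun t => (0, t, 0)), (loop_beta R A); split => //.
- by ctn.
- by rewrite act_fibre /= !add0r.
- move=> t; rewrite uc_bpt0 -[LHS]/(bpt _ (tor (0 * ival t) (1 * ival t)) _).
  by rewrite mul1r mul0r.
Qed.

Lemma ends_c : ends (cls (loop_c R A)) (0, 0, 1).
Proof.
exists (fun t => (0, 0, t)), (loop_c R A); split => //.
- by ctn.
- by rewrite /act /= mulr0 !addr0 add0r.
- by move=> t; rewrite uc_bpt.
Qed.

Lemma ends_alpha_exp n : ends (expgz (cls (loop_alpha R A)) n) (n, 0, 0).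
Proof.
apply: (ends_expgz (pw := fun n => (n, 0, 0))) => //; first exact: ends_alpha.
- by move=> m k; rewrite /gmul /=; congr (_, _, _); ring.
- by move=> m; rewrite /ginv /=; congr (_, _, _); ring.
Qed.

Lemma ends_beta_exp n : ends (expgz (cls (loop_beta R A)) n) (0, n, 0).
Proof.
apply: (ends_expgz (pw := fun n => (0, n, 0))) => //; first exact: ends_beta.
- by move=> m k; rewrite /gmul /=; congr (_, _, _); ring.
- by move=> m; rewrite /ginv /=; congr (_, _, _); ring.
Qed.

(** The lift is based at the origin, so that r, s, u, v are determined by the
    class of f. *)
Record pointed_lift (f : MA -> MA) (F : E -> E) (r s u v : int) : Prop :=
  PointedLift {
    pl_level : level_lift F r s u v;
    pl_lift : forall e, uc 1 (F e) = f (uc 1 e);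
    pl_origin : F origin = origin }.

Lemma pointed_lift_exists (f : pointed_map R A) :
  exists F r s u v, pointed_lift f F r s u v.
Proof.
have [f0 fp] := pointed_map_pointed_over f.
have [F [r [s [m1 [m2 [[cF lF Ff Fb] FE]]]]]] :=
  over_lift (@pointed_map_continuous _ _ f) fp.
have /uc_fibre[[[a b] n] ab] : uc 1 origin = uc 1 (F origin).
  by rewrite FE uc_base f0.
have n0 : n = 0.
  have := lF origin; rewrite -ab /= add0r => /eqP.
  by rewrite intr_eq0 => /eqP.
rewrite n0 in ab.
exists (act 1 (- a, - b, 0) \o F), r, s, (m1 + b), m2; split.
- split.
  + exact: (continuous_cmp (@act_continuous R 1 _) cF).
  + by move=> e; rewrite /= lF addr0.
  + move=> a' b' e; rewrite /= Ff !act_mul; congr act.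
    by rewrite /gmul /=; congr (_, _, _); ring.
  + move=> e; rewrite /= Fb !act_mul; congr act.
    by rewrite /gmul /=; congr (_, _, _); ring.
- by move=> e; rewrite uc_act FE.
- rewrite /= -ab act_mul -[RHS](act1 1); congr act.
  by rewrite /gmul /=; congr (_, _, _); ring.
Qed.

Lemma ends_map (f : pointed_map R A) F r s u v a g h :
  pointed_lift f F r s u v -> F (act 1 g origin) = act 1 h origin ->
  ends a g -> ends (pointed_map_pi1 f a) h.
Proof.
move=> [lF FE F0] gh [l [p [cl l0 l1 pE ->]]].
have cF := ll_continuous lF.
exists (F \o l), (loop_map (@pointed_map_continuous _ _ f)
  (proj1 (pointed_map_pointed_over f)) p); split.
- exact: (continuous_cmp cF cl).
- by rewrite /= l0.
- by rewrite /= l1.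
- by move=> t; rewrite loop_mapE pE /= FE.
- exact: pi1_mapE.
Qed.

Lemma pointed_lift_alpha (f : pointed_map R A) F r s u v :
  pointed_lift f F r s u v ->
  ends (pointed_map_pi1 f (cls (loop_alpha R A))) (r, 0, 0).
Proof.
move=> hF; apply: (ends_map hF) ends_alpha.
rewrite (ll_fibre (pl_level hF)) (pl_origin hF).
by congr act; congr (_, _, _); ring.
Qed.

Lemma pointed_lift_exponents (f : pointed_map R A) F r s u v :
  pointed_lift f F r s u v -> induces_exponents f r s u v.
Proof.
move=> hF; have lF := pl_level hF; split.
- exact: ends_eq (pointed_lift_alpha hF) (ends_alpha_exp r).
- apply: ends_eq (ends_map hF _ ends_beta) _.
    by rewrite (ll_fibre lF) (pl_origin hF).
  rewrite (_ : (_, _, _) = gmul 1 (s, 0, 0) (0, r, 0)).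
    exact: endsM (ends_alpha_exp s) (ends_beta_exp r).
  by rewrite /gmul /=; congr (_, _, _); ring.
- apply: ends_eq (ends_map hF _ ends_c) _.
    by rewrite (ll_base lF) (pl_origin hF).
  rewrite (_ : (_, _, _) = gmul 1 (gmul 1 (u, 0, 0) (0, v, 0)) (0, 0, 1)).
    apply: endsM ends_c; exact: endsM (ends_alpha_exp u) (ends_beta_exp v).
  by rewrite /gmul /=; congr (_, _, _); ring.
Qed.

Lemma pointed_class_homotopic (f f' : pointed_map R A) :
  \pi_(pointed_class R A) f = \pi_(pointed_class R A) f' <->
  @homotopic_in R _ _ (@pointed_over R A) f f'.
Proof. by split => [/eqquotP/asboolP|h]//; apply/eqquotP; apply/asboolP. Qed.

Lemma pointed_class_pi1 (f f' : pointed_map R A) a :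
  \pi_(pointed_class R A) f = \pi_(pointed_class R A) f' ->
  pointed_map_pi1 f a = pointed_map_pi1 f' a.
Proof.
move=> /pointed_class_homotopic[H [cH H0 H1 HP]].
elim/pi1_ind: a => p; rewrite /pointed_map_pi1 !pi1_mapE; apply/eqP/pi1_eqP.
have cp := @loop_continuous R _ _ p.
exists (fun z => H (p z.1, z.2)); split.
- by ctn.
- by move=> t; exact: H0.
- by move=> t; exact: H1.
- move=> s /=; rewrite -[p zero]/(p (clamp 0)) -[p one]/(p (clamp 1)).
  by rewrite loop0 loop1 (HP s).1.
Qed.

(** Both r and r' are exponents of the image of alpha, and alpha has infinite
    order. *)
Lemma exponent_unique (f f' : pointed_map R A) F r s u v r' s' u' v' :
  induces_exponents f r s u v ->
  \pi_(pointed_class R A) f = \pi_(pointed_class R A) f' ->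
  pointed_lift f' F r' s' u' v' -> r' = r.
Proof.
move=> [fa _ _] ff' hF; have := pointed_lift_alpha hF.
rewrite -(pointed_class_pi1 _ ff') fa => h.
by have [] := ends_inj h (ends_alpha_exp r).
Qed.

End FundamentalGroup.

(** * The Borsuk-Ulam property *)

Section BorsukUlam.
Context {R : realType}.
Notation E := (R * R * R)%type.
Notation A := (mx2 1 1 0 1).
Notation MA := (torus_bundle R A).
Notation origin := ((0, 0, 0) : E).

Section Monodromy.
Context (h1 h2 theta : E -> R).
Hypotheses (ch1 : continuous h1) (ch2 : continuous h2)
  (h0 : forall e, (h1 e, h2 e) <> (0, 0)) (angle : is_angle h1 h2 theta).

(** A shear moves no vector across the horizontal axis, so the difference of
    the two angles has no jump. *)
Lemma shear_turn_continuous :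
  continuous (fun e => turn (h1 e + h2 e) (h2 e) - turn (h1 e) (h2 e)).
Proof.
have h0' e : (h1 e + h2 e, h2 e) <> (0, 0).
  by move=> [e1 e2]; apply: (h0 (e := e)); rewrite -[h1 e]addr0 -{1}e2 e1 e2.
have ch12 : continuous (fun e => h1 e + h2 e) by ctn.
have c1 := half_turn_continuous ch1 ch2 h0.
have c2 := half_turn_continuous ch12 ch2 h0'.
pose d e := half_turn (h1 e + h2 e) (h2 e) - half_turn (h1 e) (h2 e).
have cd : continuous d by rewrite /d; ctn.
have cNd : continuous (fun e => - d e) by ctn.
move=> e.
have -> : (fun e => turn (h1 e + h2 e) (h2 e) - turn (h1 e) (h2 e)) =
    (fun e => if h2 e <= 0 then - d e else d e).
  by apply/funext => e'; rewrite /turn /d; case: ifP => _; lra.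
refine (@paste_at R _ _ h2 0 (fun e => - d e) d e (ch2 (x := e)) (cNd e) (cd e)
  _).
by move=> e0; rewrite /d e0 addr0 subrr oppr0.
Qed.

(** The angle theta grows by n along alpha and by some w along beta. Its growth
    under c, up to the beta-periodic turn caused by the shear, is a constant m;
    comparing it at e and at beta e, where c beta = alpha beta c, gives
    n + w = w. *)
Lemma no_odd_winding (n : int) :
  (forall e, h1 (act 1 (0, 1, 0) e) = h1 e) ->
  (forall e, h2 (act 1 (0, 1, 0) e) = h2 e) ->
  (forall e, h1 (act 1 (0, 0, 1) e) = h1 e + h2 e) ->
  (forall e, h2 (act 1 (0, 0, 1) e) = h2 e) ->
  (forall e, theta (act 1 (1, 0, 0) e) = theta e + n%:~R) -> n = 0.
Proof.
move=> b1 b2 c1 c2 an; have [ct tE] := angle.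
have cact g := @act_continuous R 1 g.
have ctg g : continuous (fun e => theta (act 1 g e)).
  exact: (continuous_cmp ct (cact g)).
have ctb := ctg (0, 1, 0); have ctc := ctg (0, 0, 1).
have [|e|w wE] := @int_valued_cst R
  (fun e => theta (act 1 (0, 1, 0) e) - theta e).
- by ctn.
- have [k ->] := tE (act 1 (0, 1, 0) e); have [m ->] := tE e.
  by exists (k - m); rewrite b1 b2 intrD intrN; lra.
have cd := shear_turn_continuous.
pose d e := turn (h1 e + h2 e) (h2 e) - turn (h1 e) (h2 e).
have [|e|m mE] := @int_valued_cst R
  (fun e => theta (act 1 (0, 0, 1) e) - theta e - d e).
- by rewrite /d; ctn.
- have [k ->] := tE (act 1 (0, 0, 1) e); have [l ->] := tE e.
  by exists (k - l); rewrite c1 c2 /d intrD intrN; lra.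
have dE e : d (act 1 (0, 1, 0) e) = d e by rewrite /d b1 b2.
have := mE (act 1 (0, 1, 0) origin); have := mE origin.
have -> : act 1 (0, 0, 1) (act 1 (0, 1, 0) origin) =
    act 1 (1, 0, 0) (act 1 (0, 1, 0) (act 1 (0, 0, 1) origin)).
  by rewrite !act_mul.
have := wE origin; have := wE (act 1 (0, 0, 1) origin).
rewrite an dE => w1 w2 m1 m2.
have : n%:~R = 0 :> R by lra.
by move=> /eqP; rewrite intr_eq0 => /eqP.
Qed.

End Monodromy.

(** Without coincidences, F (T e) - F e - (r/2, 0) is a nonvanishing planar
    map, odd under T, hence with odd winding number along alpha = T^2. *)
Lemma even_coincidence (f : MA -> MA) (tau : MA -> MA) F T (k s u v : int) :
  pointed_lift f F (2 * k) s u v -> half_period_lift tau T ->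
  exists z, f (tau z) = f z.
Proof.
move=> [[cF lF Ff Fb] FE _] hT; have cT := hp_continuous hT.
apply: contrapT => no.
pose h1 e := (F (T e)).1.1 - (F e).1.1 - k%:~R.
pose h2 e := (F (T e)).1.2 - (F e).1.2.
have ch1 : continuous h1 by rewrite /h1; ctn.
have ch2 : continuous h2 by rewrite /h2; ctn.
have h0 e : (h1 e, h2 e) <> (0, 0).
  move=> [e1 e2]; apply: no; exists (uc 1 e).
  rewrite -(hp_lift hT) -!FE -[RHS](uc_act 1 (k, 0, 0)) act_fibre; congr uc.
  rewrite [LHS]surjective_pairing [X in (X, _)]surjective_pairing.
  rewrite !lF (hp_level hT); congr (_, _, _).
    by move: e1; rewrite /h1; lra.
  by move: e2; rewrite /h2 addr0; lra.
have FTT e : F (T (T e)) = act 1 (2 * k, 0, 0) (F e).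
  by rewrite (hp_square hT) Ff; congr act; congr (_, _, _); ring.
have h1T e : h1 (T e) = - h1 e by rewrite /h1 FTT /= intrM; ring.
have h2T e : h2 (T e) = - h2 e by rewrite /h2 FTT /=; ring.
have [theta angle] := angle_exists ch1 ch2 h0.
have [n nE] := angle_odd h0 angle cT h1T h2T.
suff : 1 + n + n = 0 by lia.
apply: (no_odd_winding ch1 ch2 h0 angle) => e.
- by rewrite /h1 (hp_deck hT) !Ff !act_fibre /=; ring.
- by rewrite /h2 (hp_deck hT) !Ff !act_fibre /=; ring.
- by rewrite /h1 /h2 (hp_deck hT) !Fb /act /= !mul1r; ring.
- by rewrite /h2 (hp_deck hT) !Fb /=; ring.
- by rewrite -(hp_square hT) !nE !intrD; lra.
Qed.

Lemma level_lift_deck F r s u v : @level_lift R F r s u v ->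
  forall g, exists h, forall e, F (act 1 g e) = act 1 h (F e).
Proof.
move=> [cF lF Ff Fb].
pose S g := exists h, forall e, F (act 1 g e) = act 1 h (F e).
have SM g h : S g -> S h -> S (gmul 1 g h).
  move=> [g' gE] [h' hE]; exists (gmul 1 g' h') => e.
  by rewrite -!act_mul gE hE.
have SV g : S g -> S (ginv 1 g).
  move=> [g' gE]; exists (ginv 1 g') => e.
  by rewrite -[in RHS](actVK 1 g e) gE actK.
move=> [[a b] n].
have := @gen_mem 1 S SM SV 1 0 0 _ _ _ a b n; rewrite mul1r !mul0r !addr0.
by apply; eexists => e; [exact: Ff|exact: Ff|exact: Fb].
Qed.

Lemma level_lift_uc F r s u v : @level_lift R F r s u v ->
  forall e e', uc 1 e = uc 1 e' -> uc 1 (F e) = uc 1 (F e').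
Proof.
move=> lF e e' /uc_fibre[g <-]; have [h hE] := level_lift_deck lF g.
by rewrite hE uc_act.
Qed.

Lemma level_lift_pointed F r s u v (f : MA -> MA) : level_lift F r s u v ->
  F origin = origin -> (forall e, f (uc 1 e) = uc 1 (F e)) -> pointed_over f.
Proof.
move=> lF F0 fE; split; first by rewrite -(uc_base 1) fE F0.
by move=> z; have [e <-] := uc_surj z; rewrite fE !bproj_uc (ll_level lF).
Qed.

Definition mix (F F' : E -> E) (e : E) (t : R) : E :=
  ((F e).1.1 + t * ((F' e).1.1 - (F e).1.1),
   (F e).1.2 + t * ((F' e).1.2 - (F e).1.2), e.2).

(** The conditions of equivariance are affine in the lift. *)
Lemma mix_level_lift F F' r s u v t : level_lift F r s u v ->
  level_lift F' r s u v -> level_lift (mix F F' ^~ t) r s u v.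
Proof.
move=> [cF lF Ff Fb] [cF' lF' Ff' Fb']; split => //.
- by rewrite /mix; ctn.
- by move=> a b e; rewrite /mix Ff Ff' !act_fibre /=; congr (_, _, _); ring.
- move=> e; rewrite /mix Fb Fb' /act /=; congr (_, _, _); rewrite ?mul1r; ring.
Qed.

(** Maps whose lifts have the same equivariance are homotopic along segments. *)
Lemma same_exponents_homotopic (f f' : pointed_map R A) F F' r s u v :
  pointed_lift f F r s u v -> pointed_lift f' F' r s u v ->
  \pi_(pointed_class R A) f = \pi_(pointed_class R A) f'.
Proof.
move=> [lF FE F0] [lF' FE' F'0]; apply/pointed_class_homotopic.
have cF := ll_continuous lF; have cF' := ll_continuous lF'.
have ci := @ival_continuous R.
have lmix t := mix_level_lift t lF lF'.
have [||H cH HE] := @descend_homotopy _ _ (I01 R) _ (uc 1)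
  (fun z => uc 1 (mix F F' z.1 (ival z.2))) (@uc_open R 1) (@uc_surj R 1).
- by apply: (continuous_cmp (@uc_continuous R 1)); rewrite /mix; ctn.
- by move=> e e' t /(level_lift_uc (lmix (ival t))).
exists H; split => //.
- move=> z; have [e <-] := uc_surj z; rewrite HE /= ival0 -FE; congr uc.
  by rewrite /mix !mul0r !addr0 -(ll_level lF); case: (F e) => -[].
- move=> z; have [e <-] := uc_surj z; rewrite HE /= ival1 -FE'; congr uc.
  by rewrite /mix !mul1r !subrKC -(ll_level lF'); case: (F' e) => -[].
- move=> t; apply: (level_lift_pointed (lmix (ival t))); last first.
    by move=> e; exact: HE.
  by rewrite /mix F0 F'0 /= subrr mulr0 addr0.
Qed.

(** Averaging over T makes F (T e) - F e constant: it is half the image of the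
    period T^2 = alpha, that is (r/2, 0). The correction depending on the height
    restores the base point and the exponents u and v; it solves
    c1 (t + 1) = c1 t + c2 t + u and c2 (t + 1) = c2 t + v. *)
Lemma averaged_lift (tau : MA -> MA) (T : E -> E) (r s u v : int) :
  half_period_lift tau T -> exists F, [/\ level_lift F r s u v,
    F origin = origin &
    forall e, F (T e) = ((F e).1.1 + 2^-1 * r%:~R, (F e).1.2, (F e).2)].
Proof.
move=> hT; have cT := hp_continuous hT.
pose r' : R := r%:~R; pose s' : R := s%:~R.
pose u' : R := u%:~R; pose v' : R := v%:~R.
pose x0 := (T origin).1.1; pose y0 := (T origin).1.2.
pose c20 := - (2^-1 * (r' * y0)); pose c10 := - (2^-1 * (r' * x0 + s' * y0)).
pose c2 (t : R) := v' * t + c20.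
pose c1 (t : R) := c10 + (u' + c20 - 2^-1 * v') * t + 2^-1 * v' * (t * t).
pose F (e : E) : E :=
  (2^-1 * (r' * (e.1.1 + (T e).1.1) + s' * (e.1.2 + (T e).1.2)) + c1 e.2,
   2^-1 * (r' * (e.1.2 + (T e).1.2)) + c2 e.2, e.2).
exists F; split; first split.
- by rewrite /F /c1 /c2; ctn.
- by [].
- move=> a b e; rewrite /F (hp_deck hT) !act_fibre /=.
  by rewrite /r' /s'; congr (_, _, _); rewrite ?intrD ?intrM; field.
- move=> e; rewrite /F (hp_deck hT) /act /= /c1 /c2 !mul1r -/u' -/v'.
  by congr (_, _, _); field.
- rewrite /F /= -/x0 -/y0 /c1 /c2 /c10 /c20.
  by congr (_, _, _); field.
- move=> e; rewrite /F (hp_square hT) !act_fibre /= (hp_level hT).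
  by congr (_, _, _); rewrite -/r'; field.
Qed.

Lemma odd_no_coincidence (f : pointed_map R A) (tau : MA -> MA) F T r s u v :
  pointed_lift f F r s u v -> half_period_lift tau T -> ~ (2 %| r)%Z ->
  exists f' : pointed_map R A,
    \pi_(pointed_class R A) f' = \pi_(pointed_class R A) f /\
    forall z, f' (tau z) <> f' z.
Proof.
move=> hF hT rodd; have [F' [lF' F'0 F'T]] := averaged_lift r s u v hT.
have cF' := ll_continuous lF'.
have [|e e' |f' cf' f'E] := @descend _ _ (uc 1) (@uc_open R 1)
    (@uc_surj R 1) _ (uc 1 \o F').
- exact: (continuous_cmp (@uc_continuous R 1) cF').
- exact: (level_lift_uc lF').
pose f'' := PointedMap cf' (level_lift_pointed lF' F'0 f'E).
exists f''; split.
  by apply: (same_exponents_homotopic (F := F')) hF; split.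
move=> z; have [e <-] := uc_surj z; rewrite /= -(hp_lift hT) !f'E /= F'T.
move=> /esym/uc_fibre[[[a b] n] [/[swap] _ /[swap] nE aE]].
have n0 : n = 0 by apply: (@int_small R); lra.
apply: rodd; apply/dvdzP; exists a; apply: (@intr_inj R).
by move: aE; rewrite n0 mulr0 mul0r intrM; lra.
Qed.

Lemma borsuk_ulam_even (delta : pointed_class R A) (f : pointed_map R A)
    (tau : MA -> MA) r s u v :
  \pi_(pointed_class R A) f = delta -> induces_exponents f r s u v ->
  free_involution_over tau -> borsuk_ulam tau delta <-> (2 %| r)%Z.
Proof.
move=> <- fr /free_involution_lift[T hT]; split.
  move=> bu; apply: contrapT => rodd.
  have [F [r' [s' [u' [v' hF]]]]] := pointed_lift_exists f.
  rewrite -(exponent_unique fr erefl hF) in rodd.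
  have [f' [/bu[z fz] nof']] := odd_no_coincidence hF hT rodd.
  exact: nof' fz.
move=> /dvdzP[k rE] f' ff'.
have [F [r' [s' [u' [v' hF]]]]] := pointed_lift_exists f'.
have r'E := exponent_unique fr (esym ff') hF.
rewrite r'E rE mulrC in hF.
exact: even_coincidence hF hT.
Qed.

End BorsukUlam.

Theorem theorem16 (R : realType) :
  let A := mx2 1 1 0 1 in
  let B := mx2 1 2 0 1 in
  let MA := torus_bundle R A in
  let MB := torus_bundle R B in
  let admissible (tau : MA -> MA) :=
    free_involution_over tau /\ homeomorphic (orbit_space tau) MB in
  [/\ exists tau : MA -> MA, admissible tau,
      forall tau tau' : MA -> MA,
        admissible tau -> admissible tau' -> conjugate_maps tau tau' &
      forall (delta : pointed_class R A) (f : pointed_map R A),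
        \pi_(pointed_class R A) f = delta ->
        (exists r s u v : int, induces_exponents f r s u v) /\
        (forall r s u v : int, induces_exponents f r s u v ->
          forall tau : MA -> MA, admissible tau ->
            (borsuk_ulam tau delta <-> (2 %| r)%Z))].
Proof.
move=> A B MA MB admissible; split.
- have [tau [ftau hT]] := @half_shift_involution R.
  by exists tau; split => //; exact: half_shift_orbit_space.
- move=> tau tau' [ft ht] [ft' ht'].
  exact: free_involution_unique.
- move=> delta f fdelta; split.
    have [F [r [s [u [v hF]]]]] := pointed_lift_exists f.
    by exists r, s, u, v; exact: pointed_lift_exponents hF.
  move=> r s u v fr tau [ftau _].
  exact: borsuk_ulam_even fdelta fr ftau.
Qed.
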